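(* There is no sound and complete qualitative simulator for the class of all inputs $(M,\rho_0,s_0)$ such that the model $M$ uses only constraints of the types \emph{derivative}, \emph{add} and \emph{constant}, and no variable's magnitude or direction may change discontinuously during operating region transitions (i.e. in every transition all variables inherit both their magnitudes and their directions, and no new values are asserted). That is, no algorithm meets the sound-and-complete output specification (given in the context) on every such input.
   Context: **Syntax.** A model $M$ has finitely many variables. Each variable $X$ has a quantity space: a finite strictly increasing list of landmark symbols, each denoting a fixed but possibly unspecified extended real. The landmark $0$ denotes the number $0$. The symbols $-\infty,\infty$ may occur only as first/last landmark and are always unreachable values; a finite first or last landmark may also be declared unreachable. A quantity space may span only a part of the line, e.g. $[0,\infty)$. The qualitative magnitude of $X$ is either a reachable landmark of $X$ or an open interval between adjacent landmarks; its qualitative direction is the sign of $dX/dt$: inc ($+$), dec ($-$), std ($0$). A qualitative value is a pair $\langle\text{magnitude},\text{direction}\rangle$; a state gives a qualitative value to every variable. Constraint types: add: $X(t)+Y(t)=Z(t)$; mult: $X(t)\times Y(t)=Z(t)$; constant: $dX/dt=0$, optionally with $X$ equal to a specified landmark; derivative: $dX/dt=Y(t)$. Arguments may repeat. A constraint other than derivative may come with correspondences: tuples of landmarks of its variables required to satisfy the same relation. $M$ has finitely many operating regions. Each region has a finite set of constraints and a finite list of transitions. A transition consists of: a trigger (Boolean combination of primitives ''variable = qualitative value''); a target region; the list of variables inheriting their magnitudes and the list of those inheriting their directions; and explicit qualitative values asserted for some variables after the transition. An input is $(M,\rho_0,s_0)$: a model, an initial region, and an initial state. **Semantics.** A trajectory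 consists of an assignment of (extended) real values to all landmarks that respects the order of each quantity space and satisfies all correspondences of every region the trajectory visits, together with a finite or infinite sequence of segments, each in one region, the first in $\rho_0$. Using a local clock, a segment is given by real-valued continuously differentiable functions of time for all variables, satisfying the region's constraints at all times and staying within the reachable part of their quantity spaces. A segment is either (a) on $[0,b]$ with $0<b\le\infty$, with finitely many changes of qualitative state, where if $b=\infty$ the values at $\infty$ are the limits of the variables and their derivatives, which must exist, be finite and reachable; or (b) on $[0,\infty)$ with infinitely many changes of qualitative state, finitely many in bounded time. The first segment has state $s_0$ at its start. No trigger of the region holds at any local time $t$ with $0<t<b$ (with $b=\infty$ in case (b)). For a segment of type (a): if a trigger holds at $b$, a transition with a true trigger is taken and the next segment is in its target region, its initial values satisfying that region's constraints and the asserted values, variables inheriting magnitudes keeping their exact real values and those inheriting directions keeping the sign of their derivatives (triggers are not tested at the entry point itself). If no trigger holds at $b$, the segment is the last one, and either $b=\infty$, or at $b$ some variable is at the first (last) landmark of its quantity space with direction dec (inc), i.e. is about to leave its quantity space. A segment of type (b) is the last one. The behavior of a trajectory is its sequence of states (labelled by regions): alternately the state at a time point and the state on the following open time interval on which the state stays constant, with a transition recorded as two consecutive time-point states. The behavior tree of an input consists of all finite prefixes of behaviors of trajectories of that input (its root is the initial state); it is empty exactly when the input has no trajectory (the initial state is inconsistent). **Sound-and-complete output specification.** On a given input the algorithm must: if the behavior tree is empty, report inconsistency in finite time; if it is nonempty and finite, print exactly the behaviors forming its branches in finite time; if it is infinite, run forever printing exactly the nodes of the tree one by one, in an order in which the root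 is first and no node is printed before its ancestors, so that for every $i$ the first $i$ nodes have been printed after finitely many steps. *)

(* Defs.v *)
(* Stdlib reals, with Coquelicot for extended reals and limits. *)
From Stdlib Require Import Reals.
From Coquelicot Require Import Coquelicot.
From Stdlib Require Import List Arith Sorted.
Import ListNotations.
Local Open Scope nat_scope.

(** * Syntax of models *)

(* A symbol denotes the same number in every quantity space in which it occurs. *)
Inductive landmark : Set :=
  | LZero
  | LMinusInfinity
  | LPlusInfinity
  | LNamed (n : nat).

Record qspace : Set := QSpace {
  qs_landmarks : list landmark;
  qs_first_unreachable : bool;
  qs_last_unreachable : bool }.

Inductive magnitude : Set :=
  | AtLandmark (l : landmark)
  | Between (l1 l2 : landmark).

Inductive direction : Set := Inc | Dec | Std.

Definition qvalue : Set := (magnitude * direction)%type.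

(* Variables are the indices into the list of quantity spaces of the model;
   a state lists the qualitative values in that order. *)
Definition var : Set := nat.
Definition state : Set := list qvalue.

(* The list arguments are the correspondences. *)
Inductive constraint : Set :=
  | Add (x y z : var) (cs : list (landmark * landmark * landmark))
  | Mult (x y z : var) (cs : list (landmark * landmark * landmark))
  | Constant (x : var) (value : option landmark) (cs : list landmark)
  | Derivative (x y : var).

Inductive trigger : Set :=
  | TPrim (x : var) (q : qvalue)
  | TNot (f : trigger)
  | TAnd (f g : trigger)
  | TOr (f g : trigger).

Record transition : Set := Transition {
  tr_trigger : trigger;
  tr_target : nat;
  tr_inherit_magnitude : list var;
  tr_inherit_direction : list var;
  tr_assert : list (var * qvalue) }.

Record region : Set := Region {
  rg_constraints : list constraint;
  rg_transitions : list transition }.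

Record model : Set := Model {
  md_qspaces : list qspace;
  md_regions : list region }.

Record input : Set := Input {
  in_model : model;
  in_region : nat;
  in_state : state }.

Definition nvars (M : model) : nat := length (md_qspaces M).
Definition qspace_of (M : model) (x : var) : qspace :=
  nth x (md_qspaces M) (QSpace [] false false).
Definition landmarks_of (M : model) (x : var) : list landmark :=
  qs_landmarks (qspace_of M x).
Definition region_of (M : model) (r : nat) : region :=
  nth r (md_regions M) (Region [] []).

Definition first_landmark (Q : qspace) : option landmark :=
  hd_error (qs_landmarks Q).
Definition last_landmark (Q : qspace) : option landmark :=
  hd_error (rev (qs_landmarks Q)).

Definition reachable (Q : qspace) (l : landmark) : Prop :=
  In l (qs_landmarks Q) /\ l <> LMinusInfinity /\ l <> LPlusInfinity /\
  (qs_first_unreachable Q = true -> first_landmark Q <> Some l) /\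
  (qs_last_unreachable Q = true -> last_landmark Q <> Some l).

Definition valid_magnitude (Q : qspace) (m : magnitude) : Prop :=
  match m with
  | AtLandmark l => reachable Q l
  | Between l1 l2 => exists s t, qs_landmarks Q = s ++ l1 :: l2 :: t
  end.

Definition valid_qvalue (Q : qspace) (q : qvalue) : Prop :=
  valid_magnitude Q (fst q).

Definition valid_state (M : model) (s : state) : Prop :=
  Forall2 valid_qvalue (md_qspaces M) s.

(** * Well-formedness *)

Definition wf_qspace (Q : qspace) : Prop :=
  NoDup (qs_landmarks Q) /\
  (In LMinusInfinity (qs_landmarks Q) ->
     first_landmark Q = Some LMinusInfinity) /\
  (In LPlusInfinity (qs_landmarks Q) ->
     last_landmark Q = Some LPlusInfinity).

Definition wf_assertion (M : model) (a : var * qvalue) : Prop :=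
  fst a < nvars M /\ valid_qvalue (qspace_of M (fst a)) (snd a).

Definition wf_correspondence (M : model) (x y z : var)
    (c : landmark * landmark * landmark) : Prop :=
  let '(a, b, d) := c in
  In a (landmarks_of M x) /\ In b (landmarks_of M y) /\ In d (landmarks_of M z).

Definition wf_constraint (M : model) (c : constraint) : Prop :=
  match c with
  | Add x y z cs | Mult x y z cs =>
      x < nvars M /\ y < nvars M /\ z < nvars M /\
      Forall (wf_correspondence M x y z) cs
  | Constant x o cs =>
      x < nvars M /\ (forall l, o = Some l -> In l (landmarks_of M x)) /\
      Forall (fun l => In l (landmarks_of M x)) cs
  | Derivative x y => x < nvars M /\ y < nvars M
  end.

Fixpoint wf_trigger (M : model) (f : trigger) : Prop :=
  match f with
  | TPrim x q => wf_assertion M (x, q)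
  | TNot f => wf_trigger M f
  | TAnd f g | TOr f g => wf_trigger M f /\ wf_trigger M g
  end.

Definition wf_transition (M : model) (t : transition) : Prop :=
  wf_trigger M (tr_trigger t) /\
  tr_target t < length (md_regions M) /\
  Forall (fun x => x < nvars M) (tr_inherit_magnitude t) /\
  Forall (fun x => x < nvars M) (tr_inherit_direction t) /\
  Forall (wf_assertion M) (tr_assert t).

Definition wf_region (M : model) (r : region) : Prop :=
  Forall (wf_constraint M) (rg_constraints r) /\
  Forall (wf_transition M) (rg_transitions r).

Definition wf_model (M : model) : Prop :=
  Forall wf_qspace (md_qspaces M) /\ Forall (wf_region M) (md_regions M).

Definition wf_input (I : input) : Prop :=
  wf_model (in_model I) /\
  in_region I < length (md_regions (in_model I)) /\
  valid_state (in_model I) (in_state I).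

(** * The class of inputs *)

Definition derivative_add_constant_only (M : model) : Prop :=
  forall r c, In r (md_regions M) -> In c (rg_constraints r) ->
  match c with
  | Mult _ _ _ _ => False
  | Derivative _ _ | Add _ _ _ _ | Constant _ _ _ => True
  end.

Definition no_discontinuous_change (M : model) : Prop :=
  forall r t, In r (md_regions M) -> In t (rg_transitions r) ->
  (forall x, x < nvars M ->
     In x (tr_inherit_magnitude t) /\ In x (tr_inherit_direction t)) /\
  tr_assert t = [].

(** * Semantics *)

Section Semantics.

Variable M : model.
(* The real numbers denoted by the named landmarks. *)
Variable val : nat -> R.

Definition landmark_value (l : landmark) : Rbar :=
  match l with
  | LZero => Finite 0
  | LMinusInfinity => m_infty
  | LPlusInfinity => p_infty
  | LNamed n => Finite (val n)
  end.

Definition respects_order (Q : qspace) : Prop :=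
  Sorted Rbar_lt (map landmark_value (qs_landmarks Q)).

Definition correspondences_hold (c : constraint) : Prop :=
  match c with
  | Add _ _ _ cs =>
      Forall (fun '(a, b, d) => is_Rbar_plus (landmark_value a)
                (landmark_value b) (landmark_value d)) cs
  | Mult _ _ _ cs =>
      Forall (fun '(a, b, d) => is_Rbar_mult (landmark_value a)
                (landmark_value b) (landmark_value d)) cs
  | Constant _ (Some v) cs =>
      Forall (fun l => landmark_value l = landmark_value v) cs
  | Constant _ None _ => True
  | Derivative _ _ => True
  end.

Definition magnitude_holds (m : magnitude) (r : R) : Prop :=
  match m with
  | AtLandmark l => landmark_value l = Finite r
  | Between l1 l2 =>
      Rbar_lt (landmark_value l1) (Finite r) /\
      Rbar_lt (Finite r) (landmark_value l2)
  end.

Definition direction_holds (d : direction) (r' : R) : Prop :=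
  match d with
  | Inc => (0 < r')%R
  | Dec => (r' < 0)%R
  | Std => r' = 0%R
  end.

Definition qvalue_holds (q : qvalue) (r r' : R) : Prop :=
  magnitude_holds (fst q) r /\ direction_holds (snd q) r'.

(* The endpoints and the changes of qualitative state cut the time domain of a
   segment into open intervals. [sg_intervals] is [Some n] if there are [n] of
   them; the segment then lives on the closed interval from 0 to [sg_time n],
   which may be [p_infty]. It is [None] if there are infinitely many changes,
   on the half-line. The cutting points are [sg_time i] (for [i <= n]), with
   states [sg_point i], and [sg_between i] is the state between [sg_time i]
   and [sg_time (S i)]. *)
Record segment : Type := Segment {
  sg_region : nat;
  sg_var : var -> R -> R;
  sg_deriv : var -> R -> R;
  sg_intervals : option nat;
  sg_time : nat -> Rbar;
  sg_point : nat -> state;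
  sg_between : nat -> state }.

Definition sg_end (g : segment) : Rbar :=
  match sg_intervals g with
  | Some n => sg_time g n
  | None => p_infty
  end.

(* [p_infty] is itself a time of a segment with finitely many changes; the
   values there are limits. *)
Definition in_time (g : segment) (t : Rbar) : Prop :=
  Rbar_le (Finite 0) t /\
  match sg_intervals g with
  | Some _ => Rbar_le t (sg_end g)
  | None => Rbar_lt t (sg_end g)
  end.

Definition at_time (f : R -> R) (t : Rbar) : R :=
  match t with
  | Finite r => f r
  | _ => real (Lim f t)
  end.

Definition var_at (g : segment) (x : var) (t : Rbar) : R :=
  at_time (sg_var g x) t.
Definition deriv_at (g : segment) (x : var) (t : Rbar) : R :=
  at_time (sg_deriv g x) t.

Definition constraint_holds (g : segment) (t : Rbar) (c : constraint) : Prop :=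
  match c with
  | Add x y z _ => (var_at g x t + var_at g y t)%R = var_at g z t
  | Mult x y z _ => (var_at g x t * var_at g y t)%R = var_at g z t
  | Constant x o _ =>
      deriv_at g x t = 0%R /\
      (forall l, o = Some l -> landmark_value l = Finite (var_at g x t))
  | Derivative x y => deriv_at g x t = var_at g y t
  end.

Fixpoint trigger_holds (g : segment) (t : Rbar) (f : trigger) : Prop :=
  match f with
  | TPrim x q => qvalue_holds q (var_at g x t) (deriv_at g x t)
  | TNot f => ~ trigger_holds g t f
  | TAnd f h => trigger_holds g t f /\ trigger_holds g t h
  | TOr f h => trigger_holds g t f \/ trigger_holds g t h
  end.

(* Validity of [s] confines every variable to the reachable part of its
   quantity space. *)
Definition state_at (g : segment) (t : Rbar) (s : state) : Prop :=
  valid_state M s /\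
  forall x q, nth_error s x = Some q ->
    qvalue_holds q (var_at g x t) (deriv_at g x t).

Definition is_interval (g : segment) (i : nat) : Prop :=
  match sg_intervals g with Some n => i < n | None => True end.
Definition is_point (g : segment) (i : nat) : Prop :=
  match sg_intervals g with Some n => i <= n | None => True end.

Definition smooth (g : segment) : Prop :=
  let D r := in_time g (Finite r) in
  forall x, x < nvars M ->
  (forall r, D r -> D_in (sg_var g x) (sg_deriv g x) D r /\
                    continue_in (sg_deriv g x) D r) /\
  (in_time g p_infty ->
     ex_finite_lim (sg_var g x) p_infty /\ ex_finite_lim (sg_deriv g x) p_infty).

Definition history_ok (g : segment) : Prop :=
  sg_time g 0 = Finite 0 /\
  is_interval g 0 /\
  (forall i, is_interval g i -> Rbar_lt (sg_time g i) (sg_time g (S i))) /\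
  (sg_intervals g = None ->
     forall r : R, exists i, Rbar_lt (Finite r) (sg_time g i)) /\
  (forall i, is_point g i -> state_at g (sg_time g i) (sg_point g i)) /\
  (forall i (r : R), is_interval g i ->
     Rbar_lt (sg_time g i) (Finite r) -> Rbar_lt (Finite r) (sg_time g (S i)) ->
     state_at g (Finite r) (sg_between g i)) /\
  (* every inner time point is one at which the state changes *)
  (forall i, is_interval g i -> is_interval g (S i) ->
     ~ (sg_between g i = sg_point g (S i) /\
        sg_point g (S i) = sg_between g (S i))).

Definition segment_ok (g : segment) : Prop :=
  let r := region_of M (sg_region g) in
  smooth g /\
  history_ok g /\
  (forall t c, in_time g t -> In c (rg_constraints r) ->
     constraint_holds g t c) /\
  (forall (t : R) tr, (0 < t)%R -> Rbar_lt (Finite t) (sg_end g) ->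
     In tr (rg_transitions r) ->
     ~ trigger_holds g (Finite t) (tr_trigger tr)).

Definition leaving (g : segment) : Prop :=
  exists x l, x < nvars M /\
  ((first_landmark (qspace_of M x) = Some l /\
    qvalue_holds (AtLandmark l, Dec)
      (var_at g x (sg_end g)) (deriv_at g x (sg_end g))) \/
   (last_landmark (qspace_of M x) = Some l /\
    qvalue_holds (AtLandmark l, Inc)
      (var_at g x (sg_end g)) (deriv_at g x (sg_end g)))).

Definition enabled (g : segment) (tr : transition) : Prop :=
  In tr (rg_transitions (region_of M (sg_region g))) /\
  trigger_holds g (sg_end g) (tr_trigger tr).

Definition taken (g : segment) (tr : transition) (g' : segment) : Prop :=
  sg_region g' = tr_target tr /\
  (forall x, In x (tr_inherit_magnitude tr) ->
     var_at g' x (Finite 0) = var_at g x (sg_end g)) /\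
  (forall x, In x (tr_inherit_direction tr) ->
     sign (deriv_at g' x (Finite 0)) = sign (deriv_at g x (sg_end g))) /\
  (forall x q, In (x, q) (tr_assert tr) ->
     qvalue_holds q (var_at g' x (Finite 0)) (deriv_at g' x (Finite 0))).

End Semantics.

(* [tj_count] is the number of segments, [None] if there are infinitely many. *)
Record trajectory : Type := Trajectory {
  tj_val : nat -> R;
  tj_count : option nat;
  tj_seg : nat -> segment }.

Definition has_segment (T : trajectory) (k : nat) : Prop :=
  match tj_count T with Some n => k < n | None => True end.

Definition continues_ok (M : model) (T : trajectory) (k : nat) : Prop :=
  let g := tj_seg T k in
  match sg_intervals g with
  | None => ~ has_segment T (S k)
  | Some _ =>
      ((exists tr, enabled M (tj_val T) g tr) ->
         has_segment T (S k) /\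
         exists tr, enabled M (tj_val T) g tr /\
                    taken (tj_val T) g tr (tj_seg T (S k))) /\
      (~ (exists tr, enabled M (tj_val T) g tr) ->
         ~ has_segment T (S k) /\
         (sg_end g = p_infty \/ leaving M (tj_val T) g))
  end.

Definition is_trajectory (I : input) (T : trajectory) : Prop :=
  let M := in_model I in
  Forall (respects_order (tj_val T)) (md_qspaces M) /\
  has_segment T 0 /\
  sg_region (tj_seg T 0) = in_region I /\
  sg_point (tj_seg T 0) 0 = in_state I /\
  forall k, has_segment T k ->
    segment_ok M (tj_val T) (tj_seg T k) /\
    Forall (correspondences_hold (tj_val T))
      (rg_constraints (region_of M (sg_region (tj_seg T k)))) /\
    continues_ok M T k.

(** * Behaviors and the behavior tree *)

Inductive time_kind : Set := TimePoint | TimeInterval.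

Record item : Set := Item {
  it_region : nat;
  it_kind : time_kind;
  it_state : state }.

(* A node of the behavior tree is the path leading to it from the root. *)
Definition node : Set := list item.

Definition segment_item (g : segment) (j : nat) : item :=
  if Nat.even j
  then Item (sg_region g) TimePoint (sg_point g (Nat.div2 j))
  else Item (sg_region g) TimeInterval (sg_between g (Nat.div2 j)).

Definition segment_prefix (g : segment) (len : nat) : node :=
  map (segment_item g) (seq 0 len).

(* The value for [None] is irrelevant: such a segment is always the last one. *)
Definition segment_behavior (g : segment) : node :=
  match sg_intervals g with
  | Some n => segment_prefix g (2 * n + 1)
  | None => []
  end.

Definition behavior_prefix (T : trajectory) (h : node) : Prop :=
  exists k len,
    has_segment T k /\ 1 <= len /\
    (forall n, sg_intervals (tj_seg T k) = Some n -> len <= 2 * n + 1) /\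
    h = flat_map (fun j => segment_behavior (tj_seg T j)) (seq 0 k)
        ++ segment_prefix (tj_seg T k) len.

Definition in_tree (I : input) (h : node) : Prop :=
  exists T, is_trajectory I T /\ behavior_prefix T h.

Definition root (I : input) : node :=
  [Item (in_region I) TimePoint (in_state I)].

Definition proper_prefix (h h' : node) : Prop :=
  exists s, s <> [] /\ h' = h ++ s.

Definition is_branch (I : input) (h : node) : Prop :=
  in_tree I h /\ forall h', in_tree I h' -> ~ proper_prefix h h'.

Definition empty_tree (I : input) : Prop := forall h, ~ in_tree I h.

Definition finite_tree (I : input) : Prop :=
  exists l, forall h, in_tree I h -> In h l.

(** * Algorithms *)

(* Algorithms are the programs of a deterministic register machine whose
   registers hold binary trees (Jones's language GOTO), extended by an
   instruction that prints the content of a register. *)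

Inductive tree : Set := Leaf | Node (t u : tree).

Inductive instr : Set :=
  | INil (x : nat)
  | ICopy (x y : nat)
  | ICons (x y z : nat)
  | IHead (x y : nat)
  | ITail (x y : nat)
  | IBranch (x : nat) (l1 l2 : nat)
  | IPrint (x : nat).

Definition program : Set := list instr.

Record config : Set := Config {
  cf_pc : nat;
  cf_reg : nat -> tree;
  cf_output : list tree }.

Definition update (s : nat -> tree) (x : nat) (t : tree) : nat -> tree :=
  fun y => if Nat.eqb y x then t else s y.

Definition head (t : tree) : tree :=
  match t with Leaf => Leaf | Node u _ => u end.
Definition tail (t : tree) : tree :=
  match t with Leaf => Leaf | Node _ u => u end.

Definition exec (i : instr) (c : config) : config :=
  let '(Config pc s out) := c in
  match i with
  | INil x => Config (S pc) (update s x Leaf) out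
  | ICopy x y => Config (S pc) (update s x (s y)) out
  | ICons x y z => Config (S pc) (update s x (Node (s y) (s z))) out
  | IHead x y => Config (S pc) (update s x (head (s y))) out
  | ITail x y => Config (S pc) (update s x (tail (s y))) out
  | IBranch x l1 l2 =>
      Config (match s x with Leaf => l2 | Node _ _ => l1 end) s out
  | IPrint x => Config (S pc) s (out ++ [s x])
  end.

Definition step (p : program) (c : config) : config :=
  match nth_error p (cf_pc c) with
  | Some i => exec i c
  | None => c
  end.

Definition run (p : program) (t : tree) (k : nat) : config :=
  Nat.iter k (step p) (Config 0 (update (fun _ => Leaf) 0 t) []).

Definition output (p : program) (t : tree) (k : nat) : list tree :=
  cf_output (run p t k).

Definition halted (p : program) (t : tree) (k : nat) : Prop :=
  length p <= cf_pc (run p t k).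

(** * Encoding of inputs and outputs as trees *)

Fixpoint enc_nat (n : nat) : tree :=
  match n with 0 => Leaf | S n => Node Leaf (enc_nat n) end.

Definition enc_list {A : Type} (enc : A -> tree) (l : list A) : tree :=
  fold_right (fun a t => Node (enc a) t) Leaf l.

(* The [k]-th constructor of a datatype with the encodings of its arguments. *)
Definition enc_constr (k : nat) (args : list tree) : tree :=
  Node (enc_nat k) (enc_list (fun t => t) args).

Definition enc_bool (b : bool) : tree :=
  if b then enc_constr 1 [] else enc_constr 0 [].

Definition enc_option {A : Type} (enc : A -> tree) (o : option A) : tree :=
  match o with
  | None => enc_constr 0 []
  | Some a => enc_constr 1 [enc a]
  end.

Definition enc_landmark (l : landmark) : tree :=
  match l with
  | LZero => enc_constr 0 []
  | LMinusInfinity => enc_constr 1 []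
  | LPlusInfinity => enc_constr 2 []
  | LNamed n => enc_constr 3 [enc_nat n]
  end.

Definition enc_triple (c : landmark * landmark * landmark) : tree :=
  let '(a, b, d) := c in
  enc_constr 0 [enc_landmark a; enc_landmark b; enc_landmark d].

Definition enc_qspace (Q : qspace) : tree :=
  enc_constr 0 [enc_list enc_landmark (qs_landmarks Q);
                enc_bool (qs_first_unreachable Q);
                enc_bool (qs_last_unreachable Q)].

Definition enc_magnitude (m : magnitude) : tree :=
  match m with
  | AtLandmark l => enc_constr 0 [enc_landmark l]
  | Between l1 l2 => enc_constr 1 [enc_landmark l1; enc_landmark l2]
  end.

Definition enc_direction (d : direction) : tree :=
  match d with
  | Inc => enc_constr 0 []
  | Dec => enc_constr 1 []
  | Std => enc_constr 2 []
  end.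

Definition enc_qvalue (q : qvalue) : tree :=
  enc_constr 0 [enc_magnitude (fst q); enc_direction (snd q)].

Definition enc_state (s : state) : tree := enc_list enc_qvalue s.

Definition enc_constraint (c : constraint) : tree :=
  match c with
  | Add x y z cs =>
      enc_constr 0 [enc_nat x; enc_nat y; enc_nat z; enc_list enc_triple cs]
  | Mult x y z cs =>
      enc_constr 1 [enc_nat x; enc_nat y; enc_nat z; enc_list enc_triple cs]
  | Constant x o cs =>
      enc_constr 2 [enc_nat x; enc_option enc_landmark o;
                    enc_list enc_landmark cs]
  | Derivative x y => enc_constr 3 [enc_nat x; enc_nat y]
  end.

Definition enc_assertion (a : var * qvalue) : tree :=
  enc_constr 0 [enc_nat (fst a); enc_qvalue (snd a)].

Fixpoint enc_trigger (f : trigger) : tree :=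
  match f with
  | TPrim x q => enc_constr 0 [enc_nat x; enc_qvalue q]
  | TNot f => enc_constr 1 [enc_trigger f]
  | TAnd f g => enc_constr 2 [enc_trigger f; enc_trigger g]
  | TOr f g => enc_constr 3 [enc_trigger f; enc_trigger g]
  end.

Definition enc_transition (t : transition) : tree :=
  enc_constr 0 [enc_trigger (tr_trigger t);
                enc_nat (tr_target t);
                enc_list enc_nat (tr_inherit_magnitude t);
                enc_list enc_nat (tr_inherit_direction t);
                enc_list enc_assertion (tr_assert t)].

Definition enc_region (r : region) : tree :=
  enc_constr 0 [enc_list enc_constraint (rg_constraints r);
                enc_list enc_transition (rg_transitions r)].

Definition enc_model (M : model) : tree :=
  enc_constr 0 [enc_list enc_qspace (md_qspaces M);
                enc_list enc_region (md_regions M)].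

Definition enc_input (I : input) : tree :=
  enc_constr 0 [enc_model (in_model I);
                enc_nat (in_region I);
                enc_state (in_state I)].

Definition enc_kind (k : time_kind) : tree :=
  match k with
  | TimePoint => enc_constr 0 []
  | TimeInterval => enc_constr 1 []
  end.

Definition enc_item (i : item) : tree :=
  enc_constr 0 [enc_nat (it_region i); enc_kind (it_kind i);
                enc_state (it_state i)].

Inductive message : Set :=
  | Inconsistent
  | Behavior (h : node).

Definition enc_message (m : message) : tree :=
  match m with
  | Inconsistent => enc_constr 0 []
  | Behavior h => enc_constr 1 [enc_list enc_item h]
  end.

(* Encodings are injective, so that no information about the input is hidden
   from a program, and its output is unambiguous. *)

Lemma enc_nat_inj m n : enc_nat m = enc_nat n -> m = n.
Proof.
  revert n; induction m as [|m IH]; intros [|n]; simpl; intros H;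
    try discriminate; auto.
  injection H; auto.
Qed.

Lemma enc_list_inj (A : Type) (enc : A -> tree) :
  (forall a b, enc a = enc b -> a = b) ->
  forall l l', enc_list enc l = enc_list enc l' -> l = l'.
Proof.
  intros He l; induction l as [|a l IH]; intros [|b l']; simpl; intros H;
    try discriminate; auto.
  injection H; intros; f_equal; auto.
Qed.

Lemma enc_constr_inj k l k' l' :
  enc_constr k l = enc_constr k' l' -> k = k' /\ l = l'.
Proof.
  intros H; injection H; intros H2 H1; split.
  - exact (enc_nat_inj _ _ H1).
  - apply (enc_list_inj _ (fun t => t)); auto.
Qed.

Lemma cons_inv (A : Type) (a b : A) l l' : a :: l = b :: l' -> a = b /\ l = l'.
Proof. intros H; injection H; auto. Qed.

Ltac enc_inj :=
  let H := fresh in let E := fresh in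
  intros H; apply enc_constr_inj in H; destruct H as [E H];
  first [discriminate E | clear E];
  repeat (let H' := fresh in apply cons_inv in H; destruct H as [H' H]);
  clear H; f_equal; eauto using enc_nat_inj, enc_list_inj.

Lemma enc_bool_inj a b : enc_bool a = enc_bool b -> a = b.
Proof. destruct a, b; simpl; enc_inj. Qed.

Lemma enc_option_inj (A : Type) (enc : A -> tree) :
  (forall a b, enc a = enc b -> a = b) ->
  forall o o', enc_option enc o = enc_option enc o' -> o = o'.
Proof. intros He [a|] [b|]; simpl; enc_inj. Qed.

Lemma enc_landmark_inj a b : enc_landmark a = enc_landmark b -> a = b.
Proof. destruct a, b; simpl; enc_inj. Qed.

Lemma enc_triple_inj a b : enc_triple a = enc_triple b -> a = b.
Proof.
  destruct a as [[? ?] ?], b as [[? ?] ?]; simpl; enc_inj;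
    [f_equal|]; auto using enc_landmark_inj.
Qed.

Lemma enc_qspace_inj a b : enc_qspace a = enc_qspace b -> a = b.
Proof.
  destruct a, b; unfold enc_qspace; simpl; enc_inj;
    eauto using enc_list_inj, enc_landmark_inj, enc_bool_inj.
Qed.

Lemma enc_magnitude_inj a b : enc_magnitude a = enc_magnitude b -> a = b.
Proof. destruct a, b; simpl; enc_inj; auto using enc_landmark_inj. Qed.

Lemma enc_direction_inj a b : enc_direction a = enc_direction b -> a = b.
Proof. destruct a, b; simpl; enc_inj. Qed.

Lemma enc_qvalue_inj a b : enc_qvalue a = enc_qvalue b -> a = b.
Proof.
  destruct a, b; unfold enc_qvalue; simpl; enc_inj;
    auto using enc_magnitude_inj, enc_direction_inj.
Qed.

Lemma enc_state_inj a b : enc_state a = enc_state b -> a = b.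
Proof. apply enc_list_inj, enc_qvalue_inj. Qed.

Lemma enc_constraint_inj a b : enc_constraint a = enc_constraint b -> a = b.
Proof.
  destruct a, b; simpl; enc_inj;
    eauto using enc_list_inj, enc_triple_inj, enc_landmark_inj, enc_option_inj.
Qed.

Lemma enc_assertion_inj a b : enc_assertion a = enc_assertion b -> a = b.
Proof.
  destruct a, b; unfold enc_assertion; simpl; enc_inj;
    auto using enc_qvalue_inj.
Qed.

Lemma enc_trigger_inj a b : enc_trigger a = enc_trigger b -> a = b.
Proof.
  revert b; induction a; intros []; simpl; enc_inj; auto using enc_qvalue_inj.
Qed.

Lemma enc_transition_inj a b : enc_transition a = enc_transition b -> a = b.
Proof.
  destruct a, b; unfold enc_transition; simpl; enc_inj;
    eauto using enc_trigger_inj, enc_list_inj, enc_nat_inj, enc_assertion_inj.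
Qed.

Lemma enc_region_inj a b : enc_region a = enc_region b -> a = b.
Proof.
  destruct a, b; unfold enc_region; simpl; enc_inj;
    eauto using enc_list_inj, enc_constraint_inj, enc_transition_inj.
Qed.

Lemma enc_model_inj a b : enc_model a = enc_model b -> a = b.
Proof.
  destruct a, b; unfold enc_model; simpl; enc_inj;
    eauto using enc_list_inj, enc_qspace_inj, enc_region_inj.
Qed.

Lemma enc_input_inj a b : enc_input a = enc_input b -> a = b.
Proof.
  destruct a, b; unfold enc_input; simpl; enc_inj;
    auto using enc_model_inj, enc_state_inj.
Qed.

Lemma enc_kind_inj a b : enc_kind a = enc_kind b -> a = b.
Proof. destruct a, b; simpl; enc_inj. Qed.

Lemma enc_item_inj a b : enc_item a = enc_item b -> a = b.
Proof.
  destruct a, b; unfold enc_item; simpl; enc_inj;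
    auto using enc_kind_inj, enc_state_inj.
Qed.

Lemma enc_message_inj a b : enc_message a = enc_message b -> a = b.
Proof.
  destruct a, b; simpl; enc_inj; eauto using enc_list_inj, enc_item_inj.
Qed.

(** * The output specification *)

Definition reports_inconsistency (p : program) (I : input) : Prop :=
  exists k, halted p (enc_input I) k /\
    output p (enc_input I) k = [enc_message Inconsistent].

Definition prints_branches (p : program) (I : input) : Prop :=
  exists k hs, halted p (enc_input I) k /\
    output p (enc_input I) k = map (fun h => enc_message (Behavior h)) hs /\
    forall h, In h hs <-> is_branch I h.

Definition enumerates_tree (p : program) (I : input) : Prop :=
  (forall k, ~ halted p (enc_input I) k) /\
  exists e : nat -> node,
    (forall k, exists n, output p (enc_input I) k =
       map (fun i => enc_message (Behavior (e i))) (seq 0 n)) /\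
    (forall i, exists k, i <= length (output p (enc_input I) k)) /\
    (forall h, in_tree I h <-> exists i, e i = h) /\
    e 0 = root I /\
    (forall i h, in_tree I h -> proper_prefix h (e i) ->
       exists j, j < i /\ e j = h).

Definition sound_and_complete_on (p : program) (I : input) : Prop :=
  (empty_tree I -> reports_inconsistency p I) /\
  (~ empty_tree I -> finite_tree I -> prints_branches p I) /\
  (~ finite_tree I -> enumerates_tree p I).

(* Main.v *)
(* Given a program p, we construct an input whose model runs p on the encoding
   of that very input until p prints its first message. If p has reported
   inconsistency, the model runs on forever, so that a trajectory exists; if p
   has printed a behavior, the model enters a region without solutions, so that
   none exists. Either way the first message of p is wrong.

   The model simulates a counter machine, one region per instruction. A harmonic
   oscillator measures the time of an instruction, and adding (subtracting) the
   integral of its nonnegative part h (1 - cos t) over one period moves a counter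
   by one unit of 2 pi h smoothly, with all speeds zero at the transitions. The
   amplitude h is not determined by the input, but linearity makes it a mere
   scale factor. Trees are stored in counters by means of the Cantor pairing. The
   input contains a chain of increments of length n, where n is the code of the
   remaining components of the input; the machine thus finds n in a counter and
   can rebuild both these components and the chain. *)

(* The available constraints are linear and transitions may not reset anything, so discrete steps
   must come from smooth dynamics. A period of the oscillator ends with c and s back at 0 and every
   counter at rest; the next region can then give the counters other speeds without changing any
   direction. Emptiness of the tree is a claim about all trajectories: c > 0 inside the period keeps
   triggers from firing early, two complementary triggers force a jump at 2 pi, and a quantity space
   without finite ends leaves no other way to stop. Hence an input has a trajectory exactly when its
   machine run avoids [Bad].

   The self-reference is that of the recursion theorem. The obstacle is that all counters start at
   0: data can be supplied only by instructions, which themselves belong to the input to be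
   described. The chain overcomes this because one number is both the data and the chain's length,
   and its regions are alike up to an address. The first message suffices because it alone tells
   whether the tree is empty. *)
From Stdlib Require Import Reals Lra Lia.
From Coquelicot Require Import Coquelicot.
From Stdlib Require Import List Arith ZArith Cantor.
From Stdlib Require Import FunctionalExtensionality Classical.
Require Import Defs.
Import ListNotations.
Local Open Scope R_scope.

(** * One-sided derivatives *)

Lemma limit1_in_subset (f : R -> R) (D D' : R -> Prop) (l x : R) :
  (forall y, D' y -> D y) -> limit1_in f D l x -> limit1_in f D' l x.
Proof.
  intros H L eps He; destruct (L eps He) as [a [Ha La]].
  exists a; split; auto.
  intros y [Hy Hd]; apply La; auto.
Qed.

Lemma D_in_of_derivable (f df : R -> R) (D : R -> Prop) (x : R) :
  derivable_pt_lim f x (df x) -> D_in f df D x.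
Proof.
  intros H%derivable_pt_lim_D_in; unfold D_in in *.
  eapply limit1_in_subset, H; intros y [_ Hy]; split; [exact I | exact Hy].
Qed.

Lemma continue_in_of_continuity (f : R -> R) (D : R -> Prop) (x : R) :
  continuity_pt f x -> continue_in f D x.
Proof.
  intros H; unfold continuity_pt, continue_in in *.
  eapply limit1_in_subset, H; intros y [_ Hy]; split; [exact I | exact Hy].
Qed.

Lemma D_in_ext (f g df dg : R -> R) (D : R -> Prop) (x : R) :
  (forall y, D y -> f y = g y) -> D x -> df x = dg x ->
  D_in f df D x -> D_in g dg D x.
Proof.
  intros Hf Dx Hd H eps He; destruct (H eps He) as [a [Ha La]].
  exists a; split; auto.
  intros y [[Dy Hy] Hd']; rewrite <- !Hf, <- Hd by auto.
  apply La; repeat split; auto.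
Qed.

(* Extending the function constantly outside [0, t] reduces the one-sided
   derivatives at the ends to the usual mean value theorem. *)
Lemma D_in_zero_constant (f : R -> R) (D : R -> Prop) (t : R) :
  0 <= t -> (forall x, 0 <= x <= t -> D x) ->
  (forall x, 0 <= x <= t -> D_in f (fun _ => 0) D x) -> f t = f 0.
Proof.
  intros Ht HD Hf.
  destruct (Req_dec t 0) as [->|Hn]; [reflexivity|].
  set (clamp x := Rmax 0 (Rmin t x)).
  assert (Hr : forall x, 0 <= clamp x <= t).
  { intros x; unfold clamp, Rmax, Rmin.
    destruct (Rle_dec t x), (Rle_dec 0 _); lra. }
  assert (Hi : forall x, 0 <= x <= t -> clamp x = x).
  { intros x Hx; unfold clamp, Rmax, Rmin.
    destruct (Rle_dec t x), (Rle_dec 0 _); lra. }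
  assert (Hl : forall x y, Rabs (clamp x - clamp y) <= Rabs (x - y)).
  { intros x y; unfold clamp, Rmax, Rmin.
    destruct (Rle_dec t x), (Rle_dec t y);
      repeat destruct (Rle_dec 0 _); unfold Rabs;
      repeat destruct (Rcase_abs _); lra. }
  destruct (MVT_gen (fun x => f (clamp x)) 0 t (fun _ => 0)) as [c [_ Hc]].
  - rewrite Rmin_left, Rmax_right by lra; intros x Hx.
    apply is_derive_Reals; intros eps He.
    destruct (Hf x ltac:(lra) eps He) as [a [Ha La]].
    assert (Hp : 0 < Rmin a (Rmin x (t - x))).
    { repeat apply Rmin_glb_lt; lra. }
    exists (mkposreal _ Hp); intros h Hh Hha; simpl in Hha.
    assert (B1 := Rmin_l a (Rmin x (t - x))).
    assert (B2 := Rmin_r a (Rmin x (t - x))).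
    assert (B3 := Rmin_l x (t - x)); assert (B4 := Rmin_r x (t - x)).
    assert (Hb : - Rmin a (Rmin x (t - x)) < h < Rmin a (Rmin x (t - x)))
      by (apply Rabs_def2 in Hha; lra).
    rewrite !Hi by lra.
    assert (Hy : D (x + h)) by (apply HD; lra).
    specialize (La (x + h)); simpl in La; unfold Rdist in La.
    replace (x + h - x) with h in La by ring.
    apply La; repeat split; auto; lra.
  - intros x _; unfold continuity_pt, continue_in; intros eps He.
    destruct (cont_deriv _ _ _ _ (Hf (clamp x) (Hr x)) eps He) as [a [Ha La]].
    exists a; split; [exact Ha|].
    intros y [_ Hy]; simpl in *; unfold Rdist in *.
    destruct (Req_dec (clamp x) (clamp y)) as [E|E].
    (* The limit behind [cont_deriv] is punctured, so it says nothing when both points clamp to the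
       same one. *)
    + rewrite E, Rminus_diag, Rabs_R0; exact He.
    + apply La; repeat split; auto.
      eapply Rle_lt_trans; [apply Hl | exact Hy].
  - rewrite !Hi in Hc by lra; lra.
Qed.

Section HarmonicOscillator.

Variables (D : R -> Prop) (T : R) (c s dc ds : R -> R) (A : R).
Hypotheses
  (D_interval : forall x, 0 <= x <= T -> D x)
  (D_c : forall x, D x -> D_in c dc D x)
  (D_s : forall x, D x -> D_in s ds D x)
  (dc_eq : forall x, D x -> dc x = s x)
  (ds_eq : forall x, D x -> ds x = A - c x)
  (c_0 : c 0 = 0) (s_0 : s 0 = 0).

(* Rotating the phase point by the angle [- x] makes it constant. *)
Lemma oscillator_solution : 0 <= T ->
  c T = A - A * cos T /\ s T = A * sin T.
Proof using D_interval D_c D_s dc_eq ds_eq c_0 s_0.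
  intros HT.
  assert (HS : forall x, D x -> D_in sin cos D x)
    by (intros; apply D_in_of_derivable, derivable_pt_lim_sin).
  assert (HC : forall x, D x -> D_in cos (fun x => - sin x) D x)
    by (intros; apply D_in_of_derivable, derivable_pt_lim_cos).
  assert (HY : forall x, D x -> D_in (fun x => A - c x) (fun x => 0 - dc x) D x)
    by (intros x Hx; apply (Dminus D (fun _ => 0) dc (fun _ => A) c);
        [apply Dconst | auto]).
  assert (P : s T * cos T - (A - c T) * sin T
            = s 0 * cos 0 - (A - c 0) * sin 0).
  { apply (D_in_zero_constant
      (fun x => s x * cos x - (A - c x) * sin x) D T HT D_interval).
    intros x Hx; apply D_interval in Hx.
    eapply D_in_ext; [reflexivity | exact Hx | |
      apply Dminus; apply Dmult; [apply D_s | apply HC | apply HY | apply HS];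
      exact Hx].
    simpl; rewrite (dc_eq x Hx), (ds_eq x Hx); ring. }
  assert (Q : s T * sin T + (A - c T) * cos T
            = s 0 * sin 0 + (A - c 0) * cos 0).
  { apply (D_in_zero_constant
      (fun x => s x * sin x + (A - c x) * cos x) D T HT D_interval).
    intros x Hx; apply D_interval in Hx.
    eapply D_in_ext; [reflexivity | exact Hx | |
      apply Dadd; apply Dmult; [apply D_s | apply HS | apply HY | apply HC];
      exact Hx].
    simpl; rewrite (dc_eq x Hx), (ds_eq x Hx); ring. }
  rewrite s_0, c_0, sin_0, cos_0 in P, Q.
  assert (E := sin2_cos2 T); unfold Rsqr in E.
  assert (P1 : s T * cos T = (A - c T) * sin T) by lra.
  assert (Q1 : s T * sin T + (A - c T) * cos T = A) by lra.
  (* [P1] and [Q1] state that the rotated point is constant; rotating back recovers [c T] and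
     [s T]. *)
  assert (C1 : A * cos T = (A - c T) * (sin T * sin T + cos T * cos T)).
  { transitivity ((s T * cos T) * sin T + (A - c T) * (cos T * cos T)).
    - rewrite <- Q1 at 1; ring.
    - rewrite P1; ring. }
  assert (S1 : A * sin T = s T * (sin T * sin T + cos T * cos T)).
  { transitivity (s T * (sin T * sin T) + (A - c T) * sin T * cos T).
    - rewrite <- Q1 at 1; ring.
    - rewrite <- P1; ring. }
  rewrite E in C1, S1; lra.
Qed.

(** By [ds_eq], [c] is [A] minus the derivative of [s], so [a * (A * y - s y)] is a primitive of
    [a * c]. *)
Lemma oscillator_integral (x dx : R -> R) (a : R) : 0 <= T ->
  (forall y, D y -> D_in x dx D y) -> (forall y, D y -> dx y = a * c y) ->
  x T = x 0 + a * (A * T - s T).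
Proof using D_interval D_s ds_eq s_0.
  intros HT HD Hd.
  assert (E : x T - a * (A * T - s T) = x 0 - a * (A * 0 - s 0)).
  { apply (D_in_zero_constant
      (fun y => x y - a * (A * y - s y)) D T HT D_interval).
    intros y Hy; apply D_interval in Hy.
    eapply D_in_ext; [reflexivity | exact Hy | |
      apply Dminus; [apply HD, Hy | apply Dmult_const, Dminus;
        [apply Dmult_const, Dx | apply D_s, Hy]]].
    simpl; rewrite (Hd y Hy), (ds_eq y Hy); ring. }
  rewrite s_0 in E; lra.
Qed.

End HarmonicOscillator.

(** * Counter machines and the models that simulate them *)

Inductive counter_op : Set :=
  | Keep
  | Up (i : nat)
  | Down (i : nat).

Definition delta (op : counter_op) (i : nat) : Z :=
  match op with
  | Keep => 0
  | Up j => if Nat.eqb i j then 1 else 0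
  | Down j => if Nat.eqb i j then -1 else 0
  end.

(* [Move op y l0 l1] performs [op], then jumps to [l0] or [l1] according to
   whether counter [y] is zero; [Bad] is a dead end. *)
Inductive minstr : Set :=
  | Move (op : counter_op) (y l0 l1 : nat)
  | Bad.

(** Counters are integers because a quantity on the whole line may become negative; the programs
    compiled below keep them natural. *)
Definition mconfig : Set := (nat * (nat -> Z))%type.

Definition mstep (P : list minstr) (cf : mconfig) : mconfig :=
  match nth_error P (fst cf) with
  | Some (Move op y l0 l1) =>
      let c i := (snd cf i + delta op i)%Z in
      ((if Z.eqb (c y) 0 then l0 else l1), c)
  | _ => cf
  end.

(* Every instruction takes one period of a harmonic oscillator [s, w] with
   amplitude [h]. Its nonnegative integral [c = h - w] touches 0 only at the
   end of the period, and counters move with speed [c], [d = - c] or 0; one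
   period changes them by [2 * PI * h], [- (2 * PI * h)] or 0. *)
Definition clock_c : var := 0%nat.
Definition clock_s : var := 1%nat.
Definition clock_w : var := 2%nat.
Definition clock_h : var := 3%nat.
Definition clock_d : var := 4%nat.
Definition counter (i : nat) : var := (5 + i)%nat.

Definition clock_constraints : list constraint :=
  [Derivative clock_c clock_s; Derivative clock_s clock_w;
   Add clock_w clock_c clock_h []; Constant clock_h None [];
   Add clock_d clock_h clock_w []].

Definition counter_constraint (op : counter_op) (i : nat) : constraint :=
  match delta op i with
  | Z0 => Constant (counter i) None []
  | Zpos _ => Derivative (counter i) clock_c
  | Zneg _ => Derivative (counter i) clock_d
  end.

Definition move_constraints (K : nat) (op : counter_op) : list constraint :=
  clock_constraints ++ map (counter_constraint op) (seq 0 K).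

(** A primitive trigger must name a direction. At the end of a period [clock_c] and all counters are
    momentarily at rest, so [Std] is the right one. *)
Definition at_zero (x : var) : trigger := TPrim x (AtLandmark LZero, Std).
Definition jump_zero (y : nat) : trigger :=
  TAnd (at_zero clock_c) (at_zero (counter y)).
Definition jump_nonzero (y : nat) : trigger :=
  TAnd (at_zero clock_c) (TNot (at_zero (counter y))).

Definition continuous_transition (K : nat) (f : trigger) (l : nat) : transition :=
  Transition f l (seq 0 (5 + K)) (seq 0 (5 + K)) [].

(** [Bad] demands h = 0, which contradicts the positive amplitude inherited on entry. Since an
    enabled transition has to be taken, this rules out the whole trajectory. *)
Definition instr_region (K : nat) (a : minstr) : region :=
  match a with
  | Move op y l0 l1 =>
      Region (move_constraints K op)
        [continuous_transition K (jump_zero y) l0;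
         continuous_transition K (jump_nonzero y) l1]
  | Bad => Region [Constant clock_h (Some LZero) []] []
  end.

(** Both ends are infinite, hence never reached, and the only finite landmark is 0: no variable can
    leave, and no landmark value is left open. *)
Definition line : qspace :=
  QSpace [LMinusInfinity; LZero; LPlusInfinity] false false.

Definition machine_model (K : nat) (P : list minstr) : model :=
  Model (repeat line (5 + K)) (map (instr_region K) P).

Definition positive : magnitude := Between LZero LPlusInfinity.
Definition negative : magnitude := Between LMinusInfinity LZero.

(** The qualitative state of c = h (1 - cos t), s = h sin t, w = h cos t and d = - c at t = 0, with
    all counters 0; of h it says only that it is positive. *)
Definition initial_state (K : nat) : state :=
  [(AtLandmark LZero, Std); (AtLandmark LZero, Inc); (positive, Std);
   (positive, Std); (AtLandmark LZero, Std)]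
  ++ repeat (AtLandmark LZero, Std) K.

Definition machine_input (K : nat) (P : list minstr) (l : nat) : input :=
  Input (machine_model K P) l (initial_state K).

Definition minstr_ok (K n : nat) (a : minstr) : Prop :=
  match a with
  | Move op y l0 l1 => (y < K)%nat /\ (l0 < n)%nat /\ (l1 < n)%nat
  | Bad => True
  end.

(** * Well-formedness of the inputs and their membership in the class *)

Lemma nvars_machine K P : nvars (machine_model K P) = (5 + K)%nat.
Proof. apply repeat_length. Qed.

Lemma qspace_machine K P x :
  (x < 5 + K)%nat -> qspace_of (machine_model K P) x = line.
Proof.
  intros Hx; unfold qspace_of.
  change (md_qspaces (machine_model K P)) with (repeat line (5 + K)).
  apply (repeat_spec (5 + K)), nth_In; rewrite repeat_length; exact Hx.
Qed.

Lemma region_machine K P l a :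
  nth_error P l = Some a ->
  region_of (machine_model K P) l = instr_region K a.
Proof.
  intros H; unfold region_of; simpl md_regions.
  apply nth_error_nth; rewrite nth_error_map, H; reflexivity.
Qed.

Lemma zero_valid : valid_magnitude line (AtLandmark LZero).
Proof. repeat split; simpl; auto; discriminate. Qed.

Lemma positive_valid : valid_magnitude line positive.
Proof. exists [LMinusInfinity], []; reflexivity. Qed.

Lemma negative_valid : valid_magnitude line negative.
Proof. exists [], [LPlusInfinity]; reflexivity. Qed.

Lemma valid_state_machine K P s :
  length s = (5 + K)%nat -> (forall q, In q s -> valid_qvalue line q) ->
  valid_state (machine_model K P) s.
Proof.
  unfold valid_state.
  change (md_qspaces (machine_model K P)) with (repeat line (5 + K)).
  generalize (5 + K)%nat; intros n <-; induction s as [|q s IH]; intros H;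
    constructor.
  - apply H; left; reflexivity.
  - apply IH; intros; apply H; right; auto.
Qed.

Lemma machine_input_wf K P l :
  (l < length P)%nat -> Forall (minstr_ok K (length P)) P ->
  wf_input (machine_input K P l).
Proof.
  intros Hl HP; repeat split.
  - apply Forall_forall.
    intros Q HQ%repeat_spec; subst Q; repeat split; simpl;
      try (intros [|[|[|]]]; auto; discriminate).
    repeat constructor; simpl; intuition discriminate.
  - simpl md_regions; apply Forall_map; eapply Forall_impl, HP.
    intros [op y l0 l1|] Hok; split; simpl.
    + assert (Hn : forall x, (x < 5 + K -> x < nvars (machine_model K P))%nat)
        by (rewrite nvars_machine; auto).
      unfold move_constraints; apply Forall_app; split.
      * unfold clock_constraints, clock_c, clock_s, clock_w, clock_h, clock_d.
        repeat (apply Forall_cons || apply Forall_nil); cbn [wf_constraint];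
          repeat split; try apply Hn; try apply Forall_nil; try lia; discriminate.
      * apply Forall_map, Forall_forall; intros i Hi%in_seq.
        unfold counter_constraint, clock_c, clock_d.
        destruct (delta op i); cbn [wf_constraint]; repeat split;
          try apply Hn; try apply Forall_nil; unfold counter; try lia; discriminate.
    + assert (Ha : forall x, (x < 5 + K)%nat ->
               wf_trigger (machine_model K P) (at_zero x)).
      { intros x Hx; split; simpl fst.
        - rewrite nvars_machine; exact Hx.
        - rewrite qspace_machine by exact Hx; apply zero_valid. }
      assert (Hs : Forall (fun x => (x < nvars (machine_model K P))%nat)
                     (seq 0 (5 + K))).
      { apply Forall_forall; intros x Hx%in_seq; rewrite nvars_machine; lia. }
      destruct Hok as (Hy & H0 & H1).
      repeat apply Forall_cons; try apply Forall_nil; split;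
        try (split; apply Ha; unfold clock_c, counter; lia);
        (split; [simpl; rewrite length_map; assumption |]);
        split; try exact Hs; split; try exact Hs; apply Forall_nil.
    + apply Forall_cons; [|apply Forall_nil].
      cbn [wf_constraint]; repeat split; try apply Forall_nil.
      * rewrite nvars_machine; unfold clock_h; lia.
      * intros l' [= <-]; unfold landmarks_of.
        rewrite qspace_machine by (unfold clock_h; lia); simpl; auto.
    + constructor.
  - simpl; rewrite length_map; exact Hl.
  - apply valid_state_machine.
    + simpl; rewrite repeat_length; reflexivity.
    + intros q Hq%in_app_or; destruct Hq as [Hq | Hq%repeat_spec];
        [simpl in Hq; repeat destruct Hq as [<-|Hq] | subst];
        try apply zero_valid; try apply positive_valid; contradiction.
Qed.

Lemma machine_model_class K P :
  derivative_add_constant_only (machine_model K P).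
Proof.
  intros r c Hr Hc; apply in_map_iff in Hr as ([op y l0 l1|] & <- & _);
    simpl in Hc.
  - repeat destruct Hc as [<-|Hc]; try exact I.
    apply in_map_iff in Hc as (i & <- & _); unfold counter_constraint.
    destruct (delta op i); exact I.
  - destruct Hc as [<-|[]]; exact I.
Qed.

Lemma machine_model_continuous K P :
  no_discontinuous_change (machine_model K P).
Proof.
  intros r t Hr Ht; apply in_map_iff in Hr as ([op y l0 l1|] & <- & _);
    simpl in Ht; [|contradiction].
  rewrite nvars_machine.
  destruct Ht as [<-|[<-|[]]]; simpl tr_inherit_magnitude;
    simpl tr_inherit_direction; split; auto;
    intros x Hx; split; apply (in_seq (5 + K)); lia.
Qed.

(** * Every trajectory follows the run of the machine *)

Lemma delta_cases op i :
  delta op i = 0%Z \/ delta op i = 1%Z \/ delta op i = (-1)%Z.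
Proof. destruct op; simpl; auto; destruct (Nat.eqb i i0); auto. Qed.

Lemma sg_end_positive M val g : history_ok M val g -> Rbar_lt 0 (sg_end g).
Proof.
  intros (H0 & Hi & Hlt & _); unfold sg_end, is_interval in *.
  destruct (sg_intervals g) as [n|]; [|exact I].
  destruct n as [|n]; [lia|].
  assert (H : forall i, (i <= n)%nat -> Rbar_lt 0 (sg_time g (S i))).
  { induction i as [|i IH]; intros Hn.
    - rewrite <- H0; apply Hlt; lia.
    - eapply Rbar_lt_trans; [apply IH; lia | apply Hlt; lia]. }
  apply H; lia.
Qed.

Lemma in_time_before g (t : R) :
  0 <= t -> Rbar_lt t (sg_end g) -> in_time g t.
Proof.
  intros H0 Ht; split; [exact H0|].
  destruct (sg_intervals g); [apply Rbar_lt_le|]; exact Ht.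
Qed.

Lemma in_time_downward g (t x : R) : in_time g t -> 0 <= x <= t -> in_time g x.
Proof.
  intros [_ Ht] [H0 Hx]; split; [exact H0|].
  destruct (sg_intervals g).
  - eapply Rbar_le_trans; [|exact Ht]; exact Hx.
  - eapply Rbar_le_lt_trans; [|exact Ht]; exact Hx.
Qed.

Lemma in_time_nonneg g (t : R) : in_time g t -> 0 <= t.
Proof. intros [H _]; exact H. Qed.

Lemma cos_lt_1 t : 0 < t < 2 * PI -> cos t < 1.
Proof.
  intros Ht; replace t with (2 * (t / 2)) by field.
  rewrite cos_2a_sin; assert (H := sin_gt_0 (t / 2) ltac:(lra) ltac:(lra)); nra.
Qed.

(** The end landmarks denote infinities, which no real value equals. *)
Lemma line_never_left K P val g : ~ leaving (machine_model K P) val g.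
Proof.
  intros (x & l & Hx & H); rewrite nvars_machine in Hx.
  rewrite qspace_machine in H by exact Hx.
  destruct H as [[[= <-] [H _]]|[[= <-] [H _]]]; discriminate H.
Qed.

(** The remaining variables w and d, and all speeds, follow from these values by the constraints of
    a [Move] region. *)
Definition represents (val : nat -> R) (K : nat) (A : R) (g : segment)
    (t : Rbar) (c : nat -> Z) : Prop :=
  var_at g clock_c t = 0 /\ var_at g clock_s t = 0 /\ var_at g clock_h t = A /\
  forall i, (i < K)%nat -> var_at g (counter i) t = IZR (c i) * (2 * PI * A).

Section Segment.

Variables (K : nat) (P : list minstr) (val : nat -> R) (g : segment).
Variables (op : counter_op) (y l0 l1 : nat) (A : R) (c : nat -> Z).
Hypotheses
  (instr : nth_error P (sg_region g) = Some (Move op y l0 l1))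
  (y_lt : (y < K)%nat)
  (ok : segment_ok (machine_model K P) val g)
  (stop : sg_intervals g <> None ->
     ~ (exists tr, enabled (machine_model K P) val g tr) ->
     sg_end g = p_infty \/ leaving (machine_model K P) val g)
  (A_pos : 0 < A)
  (start : represents val K A g 0 c).

Let D (t : R) : Prop := in_time g t.

Lemma segment_constraint t k :
  in_time g t -> In k (move_constraints K op) -> constraint_holds val g t k.
Proof using All.
  intros Ht Hk; destruct ok as (_ & _ & H & _); apply H; [exact Ht|].
  rewrite (region_machine K P _ _ instr); exact Hk.
Qed.

Lemma clock_constraint t k :
  in_time g t -> In k clock_constraints -> constraint_holds val g t k.
Proof using All.
  intros Ht Hk; apply segment_constraint; [exact Ht|].
  apply in_or_app; left; exact Hk.
Qed.

Lemma segment_D_in x t :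
  (x < 5 + K)%nat -> D t -> D_in (sg_var g x) (sg_deriv g x) D t.
Proof using All.
  intros Hx Ht; destruct ok as (H & _).
  rewrite <- (nvars_machine K P) in Hx.
  destruct (H x Hx) as [H' _]; apply H'; exact Ht.
Qed.

Lemma clock_c_deriv t : in_time g t -> deriv_at g clock_c t = var_at g clock_s t.
Proof using All.
  intros Ht; apply (clock_constraint t (Derivative clock_c clock_s) Ht).
  simpl; auto.
Qed.

Lemma clock_d_value t : in_time g t -> var_at g clock_d t = - var_at g clock_c t.
Proof using All.
  intros Ht.
  assert (H1 := clock_constraint t (Add clock_w clock_c clock_h []) Ht
    ltac:(simpl; auto)).
  assert (H2 := clock_constraint t (Add clock_d clock_h clock_w []) Ht
    ltac:(simpl; auto 6)).
  simpl in H1, H2; lra.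
Qed.

Lemma counter_deriv i t : (i < K)%nat -> in_time g t ->
  deriv_at g (counter i) t = IZR (delta op i) * var_at g clock_c t.
Proof using All.
  intros Hi Ht.
  assert (H : constraint_holds val g t (counter_constraint op i)).
  { apply segment_constraint; [exact Ht|].
    apply in_or_app; right; apply in_map, in_seq; lia. }
  unfold counter_constraint in H.
  destruct (delta_cases op i) as [E|[E|E]]; rewrite E in H |- *; simpl in H.
  - destruct H as [-> _]; ring.
  - rewrite H; ring.
  - rewrite H, clock_d_value by exact Ht; ring.
Qed.

Lemma clock_h_value t : D t -> sg_var g clock_h t = A.
Proof using All.
  intros Ht; destruct start as (_ & _ & Eh & _); rewrite <- Eh.
  apply (D_in_zero_constant _ D); [exact (in_time_nonneg g t Ht) | |].
  - intros x; apply (in_time_downward g t x Ht).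
  - intros x Hx; assert (Hx' := in_time_downward g t x Ht Hx).
    destruct (clock_constraint x (Constant clock_h None []) Hx'
      ltac:(simpl; auto)) as [E _].
    eapply D_in_ext; [reflexivity | exact Hx' | exact E |].
    apply segment_D_in; [unfold clock_h; lia | exact Hx'].
Qed.

Lemma segment_solution t : D t ->
  sg_var g clock_c t = A - A * cos t /\ sg_var g clock_s t = A * sin t /\
  forall i, (i < K)%nat -> sg_var g (counter i) t =
    IZR (c i) * (2 * PI * A) + IZR (delta op i) * (A * t - A * sin t).
Proof using All.
  intros Ht; assert (H0 := in_time_nonneg g t Ht).
  assert (Hd : forall x, 0 <= x <= t -> D x)
    by (intros x; apply (in_time_downward g t x Ht)).
  assert (Hc : forall x, D x ->
    D_in (sg_var g clock_c) (sg_deriv g clock_c) D x)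
    by (intros x; apply segment_D_in; unfold clock_c; lia).
  assert (Hs : forall x, D x ->
    D_in (sg_var g clock_s) (sg_deriv g clock_s) D x)
    by (intros x; apply segment_D_in; unfold clock_s; lia).
  assert (Ec : forall x, D x -> sg_deriv g clock_c x = sg_var g clock_s x)
    by (intros x Hx; apply (clock_c_deriv x Hx)).
  assert (Es : forall x, D x -> sg_deriv g clock_s x = A - sg_var g clock_c x).
  { intros x Hx; assert (Hh := clock_h_value x Hx).
    assert (H1 := clock_constraint x (Derivative clock_s clock_w) Hx
      ltac:(simpl; auto)).
    assert (H2 := clock_constraint x (Add clock_w clock_c clock_h []) Hx
      ltac:(simpl; auto)).
    simpl in H1, H2; rewrite H1; lra. }
  destruct start as (c0 & s0 & _ & k0); simpl in c0, s0, k0.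
  destruct (oscillator_solution D t _ _ _ _ A Hd Hc Hs Ec Es c0 s0 H0)
    as [Sc Ss].
  split; [exact Sc | split; [exact Ss |]].
  intros i Hi; rewrite <- (k0 i Hi), <- Ss.
  apply (oscillator_integral D t (sg_var g clock_c) (sg_var g clock_s)
    (sg_deriv g clock_s) A Hd Hs Es s0 (sg_var g (counter i))
    (sg_deriv g (counter i)) (IZR (delta op i)) H0).
  - intros x; apply segment_D_in; unfold counter; lia.
  - intros x Hx; apply (counter_deriv i x Hi Hx).
Qed.

Lemma at_zero_clock t : D t ->
  trigger_holds val g t (at_zero clock_c) <-> A - A * cos t = 0 /\ A * sin t = 0.
Proof using All.
  intros Ht; destruct (segment_solution t Ht) as (Ec & Es & _).
  assert (Hd := clock_c_deriv t Ht); simpl in Hd.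
  simpl; unfold qvalue_holds; simpl.
  rewrite Hd, Ec, Es; split; intros [H1 H2]; split; auto.
  - injection H1; auto.
  - rewrite H1; reflexivity.
Qed.

(** If the segment went on beyond 2 pi, both triggers would have to fail there, although the clock
    is at zero and the counter test is either true or false. This also excludes infinitely many
    changes, which take infinite time. If it ended earlier, c > 0 would disable both transitions,
    and the end would be neither infinite nor a departure from [line]. *)
Lemma segment_end : sg_end g = Finite (2 * PI) /\ sg_intervals g <> None.
Proof using All.
  assert (PI_pos := PI_RGT_0).
  assert (E0 : Rbar_lt 0 (sg_end g))
    by (destruct ok as (_ & H & _); apply (sg_end_positive _ _ _ H)).
  assert (Hle : Rbar_le (sg_end g) (2 * PI)).
  { apply Rbar_not_lt_le; intros Hlt.
    assert (Ht : D (2 * PI)) by (apply in_time_before; [lra | exact Hlt]).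
    assert (Hz : trigger_holds val g (2 * PI) (at_zero clock_c))
      by (apply at_zero_clock; [exact Ht | rewrite cos_2PI, sin_2PI; lra]).
    destruct ok as (_ & _ & _ & H).
    rewrite (region_machine K P _ _ instr) in H.
    assert (H0 := H (2 * PI) _ ltac:(lra) Hlt (or_introl eq_refl)).
    assert (H1 := H (2 * PI) _ ltac:(lra) Hlt (or_intror (or_introl eq_refl))).
    apply H1; split; [exact Hz |]; intros Hy; apply H0; split; assumption. }
  assert (Hn : sg_intervals g <> None).
  { intros E; unfold sg_end in Hle; rewrite E in Hle; exact Hle. }
  split; [|exact Hn].
  assert (He : exists e : R, sg_end g = e)
    by (clear - E0 Hle; destruct (sg_end g) as [e| |]; eauto; contradiction).
  destruct He as [e Ee]; rewrite Ee in Hle, E0; rewrite Ee.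
  f_equal; apply Rle_antisym; [exact Hle|]; apply Rnot_lt_le; intros Hlt.
  assert (He : D e).
  { split; [apply Rlt_le, E0|]; rewrite Ee.
    destruct (sg_intervals g); [apply Rle_refl | contradiction]. }
  destruct (stop Hn) as [H|H];
    [| rewrite Ee in H; discriminate H | exact (line_never_left _ _ _ _ H)].
  intros (tr & Htr & Hen); rewrite Ee in Hen.
  rewrite (region_machine K P _ _ instr) in Htr.
  assert (Hz : trigger_holds val g e (at_zero clock_c))
    by (destruct Htr as [<-|[<-|[]]]; apply Hen).
  apply at_zero_clock in Hz; [|exact He].
  simpl in E0; assert (Hcos := cos_lt_1 e ltac:(lra)); nra.
Qed.

Lemma segment_final :
  represents val K A g (sg_end g) (fun i => c i + delta op i)%Z.
Proof using All.
  destruct segment_end as [-> Hn].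
  assert (Ht : D (2 * PI)).
  { destruct segment_end as [Ee _]; split.
    - simpl; assert (H := PI_RGT_0); lra.
    - rewrite Ee; destruct (sg_intervals g); [apply Rle_refl | contradiction]. }
  destruct (segment_solution _ Ht) as (Ec & Es & Ek).
  repeat split; simpl.
  - rewrite Ec, cos_2PI; ring.
  - rewrite Es, sin_2PI; ring.
  - exact (clock_h_value _ Ht).
  - intros i Hi; rewrite (Ek i Hi), sin_2PI, plus_IZR; ring.
Qed.

(** Determinism: the triggers exclude each other, and as the unit 2 pi A is not 0, the real value of
    a counter vanishes exactly when the integer does. *)
Lemma segment_transition tr :
  let c' i := (c i + delta op i)%Z in
  enabled (machine_model K P) val g tr <->
  tr = if Z.eqb (c' y) 0 then continuous_transition K (jump_zero y) l0
       else continuous_transition K (jump_nonzero y) l1.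
Proof using All.
  intros c'.
  destruct segment_final as (Ec & Es & _ & Ek).
  assert (Ht : in_time g (sg_end g)).
  { destruct segment_end as [Ee Hn]; split; rewrite Ee.
    - simpl; assert (H := PI_RGT_0); lra.
    - destruct (sg_intervals g); [apply Rle_refl | contradiction]. }
  assert (Hz : trigger_holds val g (sg_end g) (at_zero clock_c)).
  { simpl; unfold qvalue_holds; simpl.
    rewrite clock_c_deriv, Ec, Es by exact Ht; auto. }
  assert (Hy : trigger_holds val g (sg_end g) (at_zero (counter y))
               <-> c' y = 0%Z).
  { simpl trigger_holds; unfold qvalue_holds; cbn [fst snd magnitude_holds direction_holds landmark_value].
    rewrite counter_deriv, Ec, (Ek y y_lt) by assumption.
    split; [intros [[= H] _] | intros H].
    - apply eq_IZR; fold (c' y) in H.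
      symmetry in H; apply Rmult_integral in H as [H|H]; [exact H | exfalso].
      assert (HP := Rmult_lt_0_compat _ _ PI_RGT_0 A_pos); lra.
    - fold (c' y); rewrite H; split; [f_equal; simpl; ring | ring]. }
  unfold enabled; rewrite (region_machine K P _ _ instr).
  destruct (Z.eqb_spec (c' y) 0) as [E|E]; split.
  - intros [[<-|[<-|[]]] [_ Hen]]; [reflexivity | exfalso].
    apply Hen, Hy, E.
  - intros ->; split; [left; reflexivity |].
    split; [exact Hz | apply Hy, E].
  - intros [[<-|[<-|[]]] [_ Hen]]; [exfalso | reflexivity].
    apply E, Hy, Hen.
  - intros ->; split; [right; left; reflexivity |].
    split; [exact Hz | intros H; apply E, Hy, H].
Qed.

End Segment.

(** Only the configurations before step [k] must avoid [Bad]: the trajectory still has to enter the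
    region of the first [Bad], which is where the contradiction arises. *)
Lemma trajectory_follows K P l T :
  Forall (minstr_ok K (length P)) P -> (l < length P)%nat ->
  is_trajectory (machine_input K P l) T ->
  exists A, 0 < A /\ forall k,
    let cf := Nat.iter k (mstep P) (l, fun _ => 0%Z) in
    (forall j, (j < k)%nat ->
       nth_error P (fst (Nat.iter j (mstep P) (l, fun _ => 0%Z))) <> Some Bad) ->
    has_segment T k /\ sg_region (tj_seg T k) = fst cf /\
    represents (tj_val T) K A (tj_seg T k) 0 (snd cf).
Proof.
  intros HP Hl (_ & H0 & Hr & Hs & Hk); simpl in Hr.
  set (run k := Nat.iter k (mstep P) (l, fun _ => 0%Z)).
  destruct (Hk _ H0) as ((_ & Hhist & _) & _ & _).
  destruct Hhist as (Ht0 & _ & _ & _ & Hp & _).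
  destruct (Hp 0%nat) as [_ Hs0].
  { unfold is_point; destruct (sg_intervals _); [lia | exact I]. }
  rewrite Ht0, Hs in Hs0; simpl in_state in Hs0.
  (* The amplitude is whatever value this trajectory chose for h; the initial state makes it
     positive. *)
  exists (var_at (tj_seg T 0) clock_h 0); split.
  { destruct (Hs0 clock_h _ eq_refl) as [[H _] _]; exact H. }
  induction k as [|k IH]; intros cf Hbad.
  - split; [exact H0 | split; [exact Hr|]].
    assert (Hz : forall x d, nth_error (initial_state K) x
        = Some (AtLandmark LZero, d) -> var_at (tj_seg T 0) x 0 = 0).
    { intros x d Hx; destruct (Hs0 x _ Hx) as [[= H] _]; auto. }
    split; [apply (Hz _ Std); reflexivity |].
    split; [apply (Hz _ Inc); reflexivity |].
    split; [reflexivity |].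
    intros i Hi; simpl snd; rewrite Rmult_0_l; apply (Hz _ Std).
    simpl; apply nth_error_repeat; exact Hi.
  - destruct IH as (Hseg & Hreg & Hrep).
    { intros j Hj; apply Hbad; lia. }
    assert (Hkb := Hbad k ltac:(lia)).
    subst cf; fold (run k) in *.
    change (Nat.iter (S k) (mstep P) (l, fun _ => 0%Z)) with (mstep P (run k)).
    destruct (Hk _ Hseg) as (Hok & _ & Hcont).
    assert (Hlen : (fst (run k) < length P)%nat).
    { clear -HP Hl; induction k as [|k IH]; [exact Hl|].
      change (run (S k)) with (mstep P (run k)); unfold mstep.
      destruct (nth_error P _) as [[op y l0 l1|]|] eqn:E; try exact IH.
      apply nth_error_In in E; rewrite Forall_forall in HP.
      destruct (HP _ E) as (_ & ? & ?); simpl; destruct (Z.eqb _ _); auto. }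
    apply nth_error_Some in Hlen.
    unfold mstep.
    destruct (nth_error P (fst (run k))) as [[op y l0 l1|]|] eqn:E;
      try contradiction.
    rewrite <- Hreg in E.
    assert (Hy : (y < K)%nat).
    { apply nth_error_In in E; rewrite Forall_forall in HP.
      apply (HP _ E). }
    assert (HA : 0 < var_at (tj_seg T 0) clock_h 0).
    { destruct (Hs0 clock_h _ eq_refl) as [[H _] _]; exact H. }
    assert (Hstop : sg_intervals (tj_seg T k) <> None ->
      ~ (exists tr, enabled (machine_model K P) (tj_val T) (tj_seg T k) tr) ->
      sg_end (tj_seg T k) = p_infty \/
      leaving (machine_model K P) (tj_val T) (tj_seg T k)).
    { intros Hn Hen; unfold continues_ok in Hcont.
      destruct (sg_intervals (tj_seg T k)); [|contradiction].
      destruct Hcont as [_ Hc]; apply Hc, Hen. }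
    destruct (segment_end _ _ _ _ _ _ _ _ _ _ E Hy Hok Hstop HA Hrep)
      as [_ Hn].
    assert (Hfin := segment_final _ _ _ _ _ _ _ _ _ _ E Hy Hok Hstop HA Hrep).
    assert (Htr := segment_transition _ _ _ _ _ _ _ _ _ _ E Hy Hok Hstop HA Hrep).
    cbv zeta in Htr.
    unfold continues_ok in Hcont.
    destruct (sg_intervals (tj_seg T k)); [clear Hn|contradiction].
    destruct Hcont as [Hc _].
    destruct Hc as [Hnext (tr & Hen & Htaken)].
    { eexists; apply Htr; reflexivity. }
    apply Htr in Hen; destruct Htaken as (Hreg' & Hmag & _).
    split; [exact Hnext | split].
    + rewrite Hreg', Hen; simpl.
      destruct (Z.eqb _ _); reflexivity.
    + assert (Hinh : forall x, (x < 5 + K)%nat ->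
        var_at (tj_seg T (S k)) x 0
        = var_at (tj_seg T k) x (sg_end (tj_seg T k))).
      { intros x Hx; apply Hmag; rewrite Hen.
        destruct (Z.eqb _ _); apply in_seq; lia. }
      destruct Hfin as (F1 & F2 & F3 & F4).
      repeat split.
      * rewrite Hinh, F1; [reflexivity | unfold clock_c; lia].
      * rewrite Hinh, F2; [reflexivity | unfold clock_s; lia].
      * rewrite Hinh, F3; [reflexivity | unfold clock_h; lia].
      * intros i Hi; rewrite Hinh by (unfold counter; lia).
        apply (F4 i Hi).
Qed.

Lemma no_trajectory_when_bad K P l k T :
  Forall (minstr_ok K (length P)) P -> (l < length P)%nat ->
  nth_error P (fst (Nat.iter k (mstep P) (l, fun _ => 0%Z))) = Some Bad ->
  ~ is_trajectory (machine_input K P l) T.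
Proof.
  intros HP Hl Hbad HT.
  destruct (trajectory_follows K P l T HP Hl HT) as (A & HA & H).
  (* Strong induction allows [k] to be taken as the first visit to [Bad]. *)
  revert Hbad; induction k as [k IH] using (well_founded_induction lt_wf).
  intros Hbad.
  destruct (H k) as (Hseg & Hreg & _ & _ & Hh & _).
  { intros j Hj E; exact (IH j Hj E). }
  destruct HT as (_ & _ & _ & _ & Hk).
  destruct (Hk _ Hseg) as ((_ & _ & Hc & _) & _).
  rewrite Hreg in Hc; simpl in_model in Hc.
  rewrite (region_machine _ _ _ _ Hbad) in Hc.
  destruct (Hc 0 (Constant clock_h (Some LZero) [])) as [_ E].
  - split; [apply Rle_refl|].
    destruct (Hk _ Hseg) as ((_ & Hhist & _) & _).
    apply sg_end_positive in Hhist.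
    destruct (sg_intervals _); [apply Rbar_lt_le|]; exact Hhist.
  - left; reflexivity.
  - specialize (E _ eq_refl); rewrite Hh in E; injection E; lra.
Qed.

(** * A run that avoids [Bad] is followed by a trajectory *)

Definition qualitative (r r' : R) : qvalue :=
  (if Rlt_dec 0 r then positive
   else if Rlt_dec r 0 then negative else AtLandmark LZero,
   if Rlt_dec 0 r' then Inc else if Rlt_dec r' 0 then Dec else Std).

Lemma qualitative_holds val r r' : qvalue_holds val (qualitative r r') r r'.
Proof.
  unfold qualitative; split; simpl.
  - destruct (Rlt_dec 0 r); [simpl; auto|].
    destruct (Rlt_dec r 0); simpl; auto; f_equal; lra.
  - destruct (Rlt_dec 0 r'); [simpl; auto|].
    destruct (Rlt_dec r' 0); simpl; auto; lra.
Qed.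

Lemma qualitative_valid r r' : valid_qvalue line (qualitative r r').
Proof.
  unfold qualitative, valid_qvalue; simpl.
  destruct (Rlt_dec 0 r); [apply positive_valid|].
  destruct (Rlt_dec r 0); [apply negative_valid | apply zero_valid].
Qed.

Definition same_sign (a b : R) : Prop :=
  (0 < a /\ 0 < b) \/ (a < 0 /\ b < 0) \/ (a = 0 /\ b = 0).

Lemma qualitative_eq a a' b b' :
  same_sign a b -> same_sign a' b' -> qualitative a a' = qualitative b b'.
Proof.
  unfold same_sign; intros Ha Hb; unfold qualitative.
  f_equal; repeat destruct (Rlt_dec _ _); auto; exfalso; lra.
Qed.

Lemma same_sign_scal k a b : same_sign a b -> same_sign (k * a) (k * b).
Proof.
  intros H; unfold same_sign in *.
  destruct (Rtotal_order k 0) as [Hk|[->|Hk]].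
  - destruct H as [[H1 H2]|[[H1 H2]|[-> ->]]]; [right; left; nra | left; nra |].
    right; right; lra.
  - right; right; lra.
  - destruct H as [[H1 H2]|[[H1 H2]|[-> ->]]]; [left; nra | right; left; nra |].
    right; right; lra.
Qed.

(** The exact solution with amplitude h = 1, in the order c, s, w, h, d, counters. *)
Definition run_value (op : counter_op) (c : nat -> Z) (x : var) (t : R) : R :=
  match x with
  | 0%nat => 1 - cos t
  | 1%nat => sin t
  | 2%nat => cos t
  | 3%nat => 1
  | 4%nat => cos t - 1
  | S (S (S (S (S i)))) =>
      IZR (c i) * (2 * PI) + IZR (delta op i) * (t - sin t)
  end.

Definition run_deriv (op : counter_op) (x : var) (t : R) : R :=
  match x with
  | 0%nat => sin t
  | 1%nat => cos t
  | 2%nat => - sin t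
  | 3%nat => 0
  | 4%nat => - sin t
  | S (S (S (S (S i)))) => IZR (delta op i) * (1 - cos t)
  end.

Definition run_state (K : nat) (op : counter_op) (c : nat -> Z) (t : R) : state :=
  map (fun x => qualitative (run_value op c x t) (run_deriv op x t))
    (seq 0 (5 + K)).

(** [sin] and [cos] keep their signs within a quarter period, which makes four intervals per
    segment; the state on each is sampled at its midpoint. *)
Definition quarter (i : nat) : R := INR i * (PI / 2).

Definition run_segment (K l : nat) (op : counter_op) (c : nat -> Z) : segment :=
  {| sg_region := l;
     sg_var := run_value op c;
     sg_deriv := run_deriv op;
     sg_intervals := Some 4%nat;
     sg_time i := Finite (quarter i);
     sg_point i := run_state K op c (quarter i);
     sg_between i := run_state K op c (quarter i + PI / 4) |}.

Lemma quarter_values :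
  quarter 0 = 0 /\ quarter 1 = PI / 2 /\ quarter 2 = PI /\
  quarter 3 = 3 * (PI / 2) /\ quarter 4 = 2 * PI.
Proof. unfold quarter; simpl; repeat split; field. Qed.

Lemma run_derivable op c x t :
  derivable_pt_lim (run_value op c x) t (run_deriv op x t).
Proof.
  apply is_derive_Reals.
  destruct x as [|[|[|[|[|i]]]]];
    [ change (is_derive (fun u => 1 - cos u) t (sin t))
    | apply is_derive_Reals, derivable_pt_lim_sin
    | apply is_derive_Reals, derivable_pt_lim_cos
    | apply is_derive_Reals, derivable_pt_lim_const
    | change (is_derive (fun u => cos u - 1) t (- sin t))
    | change (is_derive (fun u => IZR (c i) * (2 * PI)
        + IZR (delta op i) * (u - sin u)) t (IZR (delta op i) * (1 - cos t))) ];
    auto_derive; auto; ring.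
Qed.

Lemma run_deriv_continuous op x t : continuity_pt (run_deriv op x) t.
Proof.
  apply derivable_continuous_pt.
  destruct x as [|[|[|[|[|i]]]]].
  - apply derivable_pt_sin.
  - apply derivable_pt_cos.
  - apply derivable_pt_opp, derivable_pt_sin.
  - apply derivable_pt_const.
  - apply derivable_pt_opp, derivable_pt_sin.
  - apply derivable_pt_scal, derivable_pt_minus;
      [apply derivable_pt_const | apply derivable_pt_cos].
Qed.

Lemma run_in_time K l op c t :
  in_time (run_segment K l op c) t -> exists r, t = Finite r /\ 0 <= r <= 2 * PI.
Proof.
  destruct quarter_values as (_ & _ & _ & _ & Q4).
  intros [H1 H2]; unfold sg_end in H2; simpl in H2; rewrite Q4 in H2.
  destruct t as [r| |]; try contradiction; exists r; auto.
Qed.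

Lemma run_segment_end K l op c : sg_end (run_segment K l op c) = Finite (2 * PI).
Proof.
  destruct quarter_values as (_ & _ & _ & _ & Q4).
  unfold sg_end; simpl; rewrite Q4; reflexivity.
Qed.

Lemma run_smooth K P l op c :
  smooth (machine_model K P) (run_segment K l op c).
Proof.
  unfold smooth; intros x Hx; split.
  - intros r Hr; split.
    + apply D_in_of_derivable, run_derivable.
    + apply continue_in_of_continuity, run_deriv_continuous.
  - intros H; apply run_in_time in H as (r & [= ] & _).
Qed.

(** The inequality sin x < x is used at t and at 2 pi - t. It bounds the progress of a counter
    within a period by one unit, so no counter crosses 0 on the way. *)
Lemma sub_sin_range t : 0 < t < 2 * PI -> 0 < t - sin t < 2 * PI.
Proof.
  intros Ht; assert (H1 := sin_lt_x t ltac:(lra)).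
  assert (H2 := sin_lt_x (2 * PI - t) ltac:(lra)).
  rewrite sin_minus, sin_2PI, cos_2PI in H2; lra.
Qed.

Lemma sin_cos_same_sign i t u : (i < 4)%nat ->
  quarter i < t < quarter (S i) -> quarter i < u < quarter (S i) ->
  same_sign (sin t) (sin u) /\ same_sign (cos t) (cos u).
Proof.
  assert (HP := PI_RGT_0).
  assert (N : forall x, cos x = cos (2 * PI - x))
    by (intros; rewrite cos_minus, sin_2PI, cos_2PI; ring).
  destruct quarter_values as (Q0 & Q1 & Q2 & Q3 & Q4).
  intros Hi; destruct i as [|[|[|[|]]]]; try lia; rewrite ?Q0, ?Q1, ?Q2, ?Q3, ?Q4;
    intros Ht Hu; split; unfold same_sign.
  - left; split; apply sin_gt_0; lra.
  - left; split; apply cos_gt_0; lra.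
  - left; split; apply sin_gt_0; lra.
  - right; left; split; apply cos_lt_0; lra.
  - right; left; split; apply sin_lt_0; lra.
  - right; left; split; apply cos_lt_0; lra.
  - right; left; split; apply sin_lt_0; lra.
  - left; rewrite (N t), (N u); split; apply cos_gt_0; lra.
Qed.

Lemma run_state_constant K op c i t u : (i < 4)%nat ->
  quarter i < t < quarter (S i) -> quarter i < u < quarter (S i) ->
  run_state K op c t = run_state K op c u.
Proof.
  intros Hi Ht Hu.
  destruct (sin_cos_same_sign i t u Hi Ht Hu) as [Hs Hc].
  assert (HP := PI_RGT_0).
  assert (Hr : forall v, quarter i < v < quarter (S i) -> 0 < v < 2 * PI).
  { destruct quarter_values as (Q0 & Q1 & Q2 & Q3 & Q4).
    intros v; destruct i as [|[|[|[|]]]]; try lia;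
      rewrite ?Q0, ?Q1, ?Q2, ?Q3, ?Q4; lra. }
  apply Hr in Ht, Hu.
  assert (Hct := cos_lt_1 t Ht); assert (Hcu := cos_lt_1 u Hu).
  assert (Hst := sub_sin_range t Ht); assert (Hsu := sub_sin_range u Hu).
  assert (Hn : forall a b, same_sign a b -> same_sign (- a) (- b))
    by (unfold same_sign; intros; lra).
  assert (H1 : same_sign (1 - cos t) (1 - cos u)) by (left; lra).
  apply map_ext; intros [|[|[|[|[|j]]]]]; simpl; apply qualitative_eq; auto;
    try (apply same_sign_scal; exact H1);
    try (unfold same_sign; lra).
  (* A moving counter lies strictly between consecutive multiples of [2 * PI], so its sign depends
     on [c j] and the direction of motion only. *)
  destruct (delta_cases op j) as [E|[E|E]]; rewrite E; unfold same_sign.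
  - rewrite !Rmult_0_l.
    destruct (Rtotal_order (IZR (c j) * (2 * PI)) 0) as [|[|]]; lra.
  - destruct (Z_lt_le_dec (c j) 0) as [H|H].
    + assert (IZR (c j) <= -1) by (apply IZR_le; lia); right; left; nra.
    + assert (0 <= IZR (c j)) by (apply IZR_le; lia); left; nra.
  - destruct (Z_lt_le_dec 0 (c j)) as [H|H].
    + assert (1 <= IZR (c j)) by (apply IZR_le; lia); left; nra.
    + assert (IZR (c j) <= 0) by (apply IZR_le; lia); right; left; nra.
Qed.

Lemma run_state_at K P l op c val (t : R) :
  state_at (machine_model K P) val (run_segment K l op c) t (run_state K op c t).
Proof.
  split.
  - apply valid_state_machine; unfold run_state.
    + rewrite length_map, length_seq; reflexivity.
    + intros q Hq; apply in_map_iff in Hq as (x & <- & _).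
      apply qualitative_valid.
  - intros x q Hq; unfold run_state in Hq.
    rewrite nth_error_map, nth_error_seq in Hq.
    destruct (Nat.ltb x (5 + K)); [|discriminate Hq].
    injection Hq as <-; apply qualitative_holds.
Qed.

Lemma run_state_nth K op c t x : (x < 5)%nat ->
  nth_error (run_state K op c t) x
  = Some (qualitative (run_value op c x t) (run_deriv op x t)).
Proof. intros Hx; do 5 (destruct x as [|x]; [reflexivity|]); lia. Qed.

Lemma run_history K P l op c val :
  history_ok (machine_model K P) val (run_segment K l op c).
Proof.
  assert (HP := PI_RGT_0).
  assert (HQ : forall i, quarter (S i) = quarter i + PI / 2)
    by (intros; unfold quarter; rewrite S_INR; ring).
  destruct quarter_values as (Q0 & Q1 & Q2 & Q3 & Q4).
  unfold history_ok, is_interval, is_point; simpl sg_intervals.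
  split; [simpl; f_equal; exact Q0 |].
  split; [lia |].
  split; [intros i _; simpl; rewrite HQ; lra |].
  split; [discriminate |].
  split; [intros i _; apply run_state_at |].
  split.
  - intros i r Hi H1 H2; simpl in H1, H2; simpl sg_between.
    rewrite (run_state_constant K op c i _ r Hi); [apply run_state_at | |];
      rewrite HQ in *; lra.
  - intros i Hi HSi [H _]; simpl in H.
    assert (Hn : forall x, nth_error (run_state K op c (quarter i + PI / 4)) x
                = nth_error (run_state K op c (quarter (S i))) x)
      by (rewrite H; reflexivity).
    assert (H1 := Hn 1%nat); assert (H2 := Hn 2%nat).
    (* A change is visible in w at the first and third quarter points, where cos vanishes, and in s
       at the second, where sin does. *)
    rewrite !run_state_nth in H1, H2 by lia.
    apply (f_equal (option_map fst)) in H1, H2; simpl in H1, H2.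
    assert (HI : i = 0%nat \/ i = 1%nat \/ i = 2%nat) by lia.
    destruct HI as [HI|[HI|HI]]; subst i; rewrite ?Q0, ?Q1, ?Q2, ?Q3 in *.
    + rewrite cos_PI2 in H2.
      assert (0 < cos (0 + PI / 4)) by (apply cos_gt_0; lra).
      repeat destruct (Rlt_dec _ _); try discriminate; lra.
    + rewrite sin_PI in H1.
      assert (0 < sin (PI / 2 + PI / 4)) by (apply sin_gt_0; lra).
      repeat destruct (Rlt_dec _ _); try discriminate; lra.
    + replace (3 * (PI / 2)) with (PI / 2 + PI) in H2 by field.
      rewrite neg_cos, cos_PI2 in H2.
      assert (cos (PI + PI / 4) < 0) by (apply cos_lt_0; lra).
      repeat destruct (Rlt_dec _ _); try discriminate; lra.
Qed.

Lemma run_value_counter op c i t : run_value op c (counter i) t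
  = IZR (c i) * (2 * PI) + IZR (delta op i) * (t - sin t).
Proof. reflexivity. Qed.

Lemma run_deriv_counter op i t :
  run_deriv op (counter i) t = IZR (delta op i) * (1 - cos t).
Proof. reflexivity. Qed.

Lemma run_segment_ok K P l op y l0 l1 c val :
  nth_error P l = Some (Move op y l0 l1) ->
  segment_ok (machine_model K P) val (run_segment K l op c).
Proof.
  intros HP; unfold segment_ok; simpl sg_region.
  rewrite (region_machine K P _ _ HP).
  split; [apply run_smooth |].
  split; [apply run_history |].
  split.
  - intros t k Ht Hk; apply run_in_time in Ht as (r & -> & _).
    apply in_app_or in Hk as [Hk|Hk].
    + repeat destruct Hk as [<-|Hk]; try contradiction; simpl;
        try (split; [reflexivity | discriminate]); ring.
    + apply in_map_iff in Hk as (i & <- & _).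
      unfold counter_constraint.
      assert (Hd := run_deriv_counter op i r).
      destruct (delta_cases op i) as [E|[E|E]]; rewrite E in Hd |- *; simpl;
        simpl in Hd; rewrite Hd; [split; [ring | discriminate] | ring | ring].
  - intros t tr Ht0 Ht Htr; rewrite run_segment_end in Ht; simpl in Ht.
    assert (Hc := cos_lt_1 t (conj Ht0 Ht)).
    destruct Htr as [<-|[<-|[]]]; intros [[[= H] _] _]; lra.
Qed.

Lemma run_state_start K op :
  run_state K op (fun _ => 0%Z) (quarter 0) = initial_state K.
Proof.
  destruct quarter_values as (Q0 & _); rewrite Q0.
  assert (E : qualitative 0 0 = (AtLandmark LZero, Std)).
  { unfold qualitative; destruct (Rlt_dec 0 0); [lra | reflexivity]. }
  assert (E1 : qualitative 0 1 = (AtLandmark LZero, Inc)).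
  { unfold qualitative.
    destruct (Rlt_dec 0 0), (Rlt_dec 0 1); try lra; reflexivity. }
  assert (E2 : qualitative 1 0 = (positive, Std)).
  { unfold qualitative.
    destruct (Rlt_dec 0 0), (Rlt_dec 0 1); try lra; reflexivity. }
  assert (Ek : forall n a, (5 <= a)%nat ->
    map (fun x => qualitative (run_value op (fun _ => 0%Z) x 0)
                              (run_deriv op x 0)) (seq a n)
    = repeat (AtLandmark LZero, Std) n).
  { induction n as [|n IH]; intros a Ha; [reflexivity|].
    simpl; rewrite IH by lia; f_equal; rewrite <- E.
    do 5 (destruct a as [|a]; [lia|]); simpl; rewrite sin_0, cos_0.
    f_equal; ring. }
  unfold run_state; rewrite seq_app, map_app, (Ek K) by lia.
  unfold initial_state; f_equal.
  cbn [map seq run_value run_deriv]; rewrite sin_0, cos_0.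
  rewrite Rminus_diag, Ropp_0, E, E1, E2; reflexivity.
Qed.

Section Existence.

Variables (K : nat) (P : list minstr) (l : nat).
Hypotheses (P_ok : Forall (minstr_ok K (length P)) P) (l_lt : (l < length P)%nat).

Let run (k : nat) : mconfig := Nat.iter k (mstep P) (l, fun _ => 0%Z).

Hypothesis never_bad : forall k, nth_error P (fst (run k)) <> Some Bad.

Definition op_at (pc : nat) : counter_op :=
  match nth_error P pc with Some (Move op _ _ _) => op | _ => Keep end.

Definition run_trajectory : trajectory :=
  {| tj_val := fun _ => 0;
     tj_count := None;
     tj_seg k := run_segment K (fst (run k)) (op_at (fst (run k))) (snd (run k)) |}.

Lemma run_instr k : exists op y l0 l1,
  nth_error P (fst (run k)) = Some (Move op y l0 l1) /\ (y < K)%nat.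
Proof using P_ok l_lt never_bad.
  assert (Hl : (fst (run k) < length P)%nat).
  { induction k as [|k IH]; [exact l_lt|].
    change (run (S k)) with (mstep P (run k)); unfold mstep.
    destruct (nth_error P _) as [[op y l0 l1|]|] eqn:E; try exact IH.
    apply nth_error_In in E; rewrite Forall_forall in P_ok.
    destruct (P_ok _ E) as (_ & ? & ?); simpl; destruct (Z.eqb _ _); auto. }
  apply nth_error_Some in Hl; assert (Hb := never_bad k).
  destruct (nth_error P (fst (run k))) as [[op y l0 l1|]|] eqn:E;
    try contradiction.
  exists op, y, l0, l1; split; [reflexivity|].
  apply nth_error_In in E; rewrite Forall_forall in P_ok; apply (P_ok _ E).
Qed.

Lemma run_trajectory_ok : is_trajectory (machine_input K P l) run_trajectory.
Proof using P_ok l_lt never_bad.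
  assert (HP := PI_RGT_0).
  split; [|split; [exact I | split; [reflexivity | split]]].
  - apply Forall_forall; intros Q HQ%(repeat_spec (5 + K)); subst Q.
    repeat constructor.
  - apply run_state_start.
  - intros k _; simpl tj_val; simpl tj_seg.
    destruct (run_instr k) as (op & y & l0 & l1 & E & Hy).
    assert (Eop : op_at (fst (run k)) = op) by (unfold op_at; rewrite E; auto).
    split; [|split].
    + eapply run_segment_ok; rewrite Eop; exact E.
    + simpl in_model; simpl sg_region; rewrite (region_machine _ _ _ _ E).
      simpl; unfold move_constraints.
      apply Forall_app; split; [repeat constructor |].
      apply Forall_map, Forall_forall; intros i _; unfold counter_constraint.
      destruct (delta op i); exact I.
    + unfold continues_ok; simpl sg_intervals; cbv iota.
      simpl in_model; simpl tj_val; simpl tj_seg.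
      set (g := run_segment K (fst (run k)) (op_at (fst (run k))) (snd (run k))).
      assert (Eend : sg_end g = Finite (2 * PI)) by apply run_segment_end.
      set (n i := (snd (run k) i + delta op i)%Z).
      assert (Ek : forall i, var_at g (counter i) (sg_end g)
                             = IZR (n i) * (2 * PI)).
      { intros i; rewrite Eend; unfold n.
        change (run_value (op_at (fst (run k))) (snd (run k)) (counter i) (2 * PI)
                = IZR (snd (run k) i + delta op i) * (2 * PI)).
        rewrite Eop, run_value_counter, sin_2PI, plus_IZR; ring. }
      assert (Hc : trigger_holds (fun _ => 0) g (sg_end g) (at_zero clock_c)).
      { rewrite Eend; simpl; unfold qvalue_holds; simpl.
        rewrite cos_2PI, sin_2PI; split; [f_equal; ring | reflexivity]. }
      assert (Hyz : trigger_holds (fun _ => 0) g (sg_end g) (at_zero (counter y))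
                    <-> n y = 0%Z).
      { change (qvalue_holds (fun _ => 0) (AtLandmark LZero, Std)
          (var_at g (counter y) (sg_end g)) (deriv_at g (counter y) (sg_end g))
          <-> n y = 0%Z).
        unfold qvalue_holds.
        cbn [fst snd magnitude_holds direction_holds landmark_value].
        rewrite Ek; split.
        - intros [[= H] _]; apply eq_IZR; symmetry in H.
          apply Rmult_integral in H as [H|H]; [exact H | lra].
        - intros ->; split; [f_equal; simpl; ring |].
          rewrite Eend.
          change (run_deriv (op_at (fst (run k))) (counter y) (2 * PI) = 0).
          rewrite run_deriv_counter, cos_2PI; ring. }
      set (tr := if Z.eqb (n y) 0
                 then continuous_transition K (jump_zero y) l0
                 else continuous_transition K (jump_nonzero y) l1).
      assert (Hen : enabled (machine_model K P) (fun _ => 0) g tr).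
      { unfold enabled; simpl sg_region; rewrite (region_machine _ _ _ _ E).
        unfold tr; destruct (Z.eqb_spec (n y) 0) as [H|H].
        - split; [left; reflexivity | split; [exact Hc | apply Hyz, H]].
        - split; [right; left; reflexivity |].
          split; [exact Hc | intros H'; apply H, Hyz, H']. }
      split; [intros _ | intros H; exfalso; apply H; exists tr; exact Hen].
      split; [exact I | exists tr; split; [exact Hen |]].
      assert (En : run (S k) = ((if Z.eqb (n y) 0 then l0 else l1), n)).
      { change (run (S k)) with (mstep P (run k)); unfold mstep.
        rewrite E; reflexivity. }
      change (taken (fun _ => 0) g tr (run_segment K (fst (run (S k)))
        (op_at (fst (run (S k)))) (snd (run (S k))))).
      rewrite En; cbn [fst snd].
      generalize (op_at (if Z.eqb (n y) 0 then l0 else l1)); intros op'.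
      split; [|split; [|split]].
      * unfold tr; simpl; destruct (Z.eqb _ _); reflexivity.
      * intros x _; destruct x as [|[|[|[|[|i]]]]];
          try (rewrite Eend; unfold g, var_at; simpl;
               rewrite ?sin_0, ?cos_0, ?sin_2PI, ?cos_2PI; reflexivity).
        change (S (S (S (S (S i))))) with (counter i); rewrite Ek.
        change (run_value op' n (counter i) 0 = IZR (n i) * (2 * PI)).
        rewrite run_value_counter, sin_0; ring.
      (* Not only the signs but the speeds themselves agree: counters are at rest at both ends of a
         period whatever their operation, and the clock is periodic. *)
      * intros x _; rewrite Eend; unfold g, deriv_at; f_equal.
        destruct x as [|[|[|[|[|i]]]]]; simpl;
          rewrite ?sin_0, ?cos_0, ?sin_2PI, ?cos_2PI; ring.
      * unfold tr; destruct (Z.eqb _ _); intros x q [].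
Qed.

End Existence.

Theorem machine_tree_nonempty K P l :
  Forall (minstr_ok K (length P)) P -> (l < length P)%nat ->
  (forall k,
     nth_error P (fst (Nat.iter k (mstep P) (l, fun _ => 0%Z))) <> Some Bad) ->
  ~ empty_tree (machine_input K P l).
Proof.
  intros HP Hl Hb He; eapply He.
  exists (run_trajectory K P l); split.
  - apply run_trajectory_ok; assumption.
  - exists 0%nat, 1%nat; split; [exact I | split; [auto | split; [|reflexivity]]].
    intros n [= <-]; lia.
Qed.

Local Open Scope nat_scope.

(** * Structured programs on counters *)

Definition upd (s : nat -> nat) (x v : nat) : nat -> nat :=
  fun y => if Nat.eqb y x then v else s y.

Inductive cmd : Set :=
  | CSkip
  | CInc (x : nat)
  | CDec (x : nat)
  | CSeq (c1 c2 : cmd)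
  | CIf (x : nat) (c1 c2 : cmd)
  | CWhile (x : nat) (c : cmd).

Declare Scope cmd_scope.
Notation "c1 ;; c2" := (CSeq c1 c2) (at level 100, right associativity) : cmd_scope.
Local Open Scope cmd_scope.

(** Decrementing 0 has no rule, so a derivation certifies both termination and that no counter
    becomes negative. *)
Inductive cexec : cmd -> (nat -> nat) -> (nat -> nat) -> Prop :=
  | cexec_skip s : cexec CSkip s s
  | cexec_inc s x : cexec (CInc x) s (upd s x (S (s x)))
  | cexec_dec s x : s x <> 0 -> cexec (CDec x) s (upd s x (pred (s x)))
  | cexec_seq c1 c2 s1 s2 s3 :
      cexec c1 s1 s2 -> cexec c2 s2 s3 -> cexec (c1;; c2) s1 s3
  | cexec_if_true x c1 c2 s s' :
      s x <> 0 -> cexec c1 s s' -> cexec (CIf x c1 c2) s s'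
  | cexec_if_false x c1 c2 s s' :
      s x = 0 -> cexec c2 s s' -> cexec (CIf x c1 c2) s s'
  | cexec_while_end x c s : s x = 0 -> cexec (CWhile x c) s s
  | cexec_while_step x c s1 s2 s3 :
      s1 x <> 0 -> cexec c s1 s2 -> cexec (CWhile x c) s2 s3 ->
      cexec (CWhile x c) s1 s3.

Fixpoint csize (c : cmd) : nat :=
  match c with
  | CSkip => 0
  | CInc _ | CDec _ => 1
  | c1;; c2 => csize c1 + csize c2
  | CIf _ c1 c2 => S (csize c1 + S (csize c2))
  | CWhile _ c => S (csize c + 1)
  end.

(* A test of counter 0 with equal targets serves as an unconditional jump. *)
Fixpoint compile (c : cmd) (a : nat) : list minstr :=
  match c with
  | CSkip => []
  | CInc x => [Move (Up x) 0 (S a) (S a)]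
  | CDec x => [Move (Down x) 0 (S a) (S a)]
  | c1;; c2 => compile c1 a ++ compile c2 (a + csize c1)
  | CIf x c1 c2 =>
      let b := S (S a + csize c1) in
      Move Keep x b (S a) :: compile c1 (S a)
        ++ Move Keep 0 (b + csize c2) (b + csize c2) :: compile c2 b
  | CWhile x c =>
      Move Keep x (S (S a + csize c)) (S a) :: compile c (S a)
        ++ [Move Keep 0 a a]
  end.

Lemma compile_length c a : length (compile c a) = csize c.
Proof.
  revert a; induction c; intros a; simpl; rewrite ?length_app; simpl;
    rewrite ?IHc1, ?IHc2, ?IHc; reflexivity.
Qed.

Definition jumps_within (n : nat) (i : minstr) : Prop :=
  match i with Move _ _ l0 l1 => l0 < n /\ l1 < n | Bad => True end.

Lemma compile_jumps c a n :
  a + csize c < n -> Forall (jumps_within n) (compile c a).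
Proof.
  revert a; induction c; intros a Hn; simpl in Hn |- *; rewrite ?Forall_app.
  - apply Forall_nil.
  - repeat constructor; simpl; lia.
  - repeat constructor; simpl; lia.
  - split; [apply IHc1 | apply IHc2]; lia.
  - apply Forall_cons; [simpl; lia |].
    apply Forall_app; split; [apply IHc1; lia |].
    apply Forall_cons; [simpl; lia | apply IHc2; lia].
  - apply Forall_cons; [simpl; lia |].
    apply Forall_app; split; [apply IHc; lia |].
    repeat constructor; simpl; lia.
Qed.

Definition code_at (P : list minstr) (a : nat) (l : list minstr) : Prop :=
  forall i instr, nth_error l i = Some instr -> nth_error P (a + i) = Some instr.

Lemma code_at_app P a l l' :
  code_at P a (l ++ l') -> code_at P a l /\ code_at P (a + length l) l'.
Proof.
  intros H; split; intros i instr Hi.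
  - apply H; rewrite nth_error_app1; [exact Hi|].
    apply nth_error_Some; congruence.
  - rewrite <- Nat.add_assoc; apply H; rewrite nth_error_app2 by lia.
    rewrite <- Hi; f_equal; lia.
Qed.

Lemma code_at_cons P a i l :
  code_at P a (i :: l) -> nth_error P a = Some i /\ code_at P (S a) l.
Proof.
  intros H; split.
  - rewrite <- (H 0 i eq_refl); f_equal; lia.
  - intros j instr Hj; rewrite <- (H (S j) instr Hj); f_equal; lia.
Qed.

Definition reaches (P : list minstr) (cf cf' : mconfig) : Prop :=
  exists k, Nat.iter k (mstep P) cf = cf'.

Lemma reaches_refl P cf : reaches P cf cf.
Proof. exists 0; reflexivity. Qed.

Lemma reaches_trans P cf cf' cf'' :
  reaches P cf cf' -> reaches P cf' cf'' -> reaches P cf cf''.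
Proof.
  intros [k Hk] [k' Hk']; exists (k' + k); rewrite Nat.iter_add, Hk; exact Hk'.
Qed.

Definition counters_of (s : nat -> nat) : nat -> Z := fun i => Z.of_nat (s i).

Lemma reaches_keep P a y l0 l1 s :
  nth_error P a = Some (Move Keep y l0 l1) ->
  reaches P (a, counters_of s) (if Nat.eqb (s y) 0 then l0 else l1, counters_of s).
Proof.
  intros H; exists 1; simpl; unfold mstep; simpl; rewrite H.
  rewrite Z.add_0_r; f_equal; unfold counters_of.
  - destruct (Nat.eqb_spec (s y) 0), (Z.eqb_spec (Z.of_nat (s y)) 0); auto; lia.
  - apply functional_extensionality; intros i; apply Z.add_0_r.
Qed.

Lemma reaches_jump P a y l s :
  nth_error P a = Some (Move Keep y l l) ->
  reaches P (a, counters_of s) (l, counters_of s).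
Proof.
  intros H; assert (H' := reaches_keep P a y l l s H).
  destruct (Nat.eqb (s y) 0); exact H'.
Qed.

Lemma reaches_change P a op y l s s' :
  nth_error P a = Some (Move op y l l) ->
  (forall i, Z.of_nat (s' i) = (Z.of_nat (s i) + delta op i)%Z) ->
  reaches P (a, counters_of s) (l, counters_of s').
Proof.
  intros H E; exists 1; simpl; unfold mstep; simpl; rewrite H.
  destruct (Z.eqb _ _); f_equal; apply functional_extensionality;
    intros i; unfold counters_of; rewrite E; reflexivity.
Qed.

Lemma compile_correct P c s s' : cexec c s s' -> forall a,
  code_at P a (compile c a) ->
  reaches P (a, counters_of s) (a + csize c, counters_of s').
Proof.
  induction 1; intros a Ha; simpl in Ha |- *.
  - rewrite Nat.add_0_r; apply reaches_refl.
  - apply code_at_cons in Ha as [Ha _]; rewrite Nat.add_1_r.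
    apply (reaches_change P a _ _ _ _ _ Ha); intros i; unfold upd; simpl.
    destruct (Nat.eqb_spec i x); subst; lia.
  - apply code_at_cons in Ha as [Ha _]; rewrite Nat.add_1_r.
    apply (reaches_change P a _ _ _ _ _ Ha); intros i; unfold upd; simpl.
    destruct (Nat.eqb_spec i x); subst; lia.
  - apply code_at_app in Ha as [H1 H2]; rewrite compile_length in H2.
    eapply reaches_trans; [apply IHcexec1, H1 |].
    rewrite Nat.add_assoc; apply IHcexec2, H2.
  - apply code_at_cons in Ha as [H1 Ha]; apply code_at_app in Ha as [H2 Ha].
    apply code_at_cons in Ha as [H3 _]; rewrite compile_length in H3.
    eapply reaches_trans; [apply (reaches_keep _ _ _ _ _ _ H1) |].
    apply Nat.eqb_neq in H; rewrite H.
    eapply reaches_trans; [apply IHcexec, H2 |].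
    replace (a + S (csize c1 + S (csize c2)))
      with (S (S (a + csize c1 + csize c2))) by lia.
    apply (reaches_jump _ _ _ _ _ H3).
  - apply code_at_cons in Ha as [H1 Ha]; apply code_at_app in Ha as [_ Ha].
    apply code_at_cons in Ha as [_ H2]; rewrite compile_length in H2.
    eapply reaches_trans; [apply (reaches_keep _ _ _ _ _ _ H1) |].
    apply Nat.eqb_eq in H; rewrite H.
    replace (a + S (csize c1 + S (csize c2)))
      with (S (S a + csize c1) + csize c2) by lia.
    apply IHcexec, H2.
  - apply code_at_cons in Ha as [H1 _].
    eapply reaches_trans; [apply (reaches_keep _ _ _ _ _ _ H1) |].
    apply Nat.eqb_eq in H; rewrite H.
    replace (a + S (csize c + 1)) with (S (S a + csize c)) by lia.
    apply reaches_refl.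
  - assert (Ha' := Ha); apply code_at_cons in Ha as [H2 Ha].
    apply code_at_app in Ha as [H3 Ha].
    apply code_at_cons in Ha as [H4 _]; rewrite compile_length in H4.
    eapply reaches_trans; [apply (reaches_keep _ _ _ _ _ _ H2) |].
    apply Nat.eqb_neq in H; rewrite H.
    eapply reaches_trans; [apply IHcexec1, H3 |].
    eapply reaches_trans; [apply (reaches_jump _ _ _ _ _ H4) |].
    apply IHcexec2, Ha'.
Qed.

(** * Arithmetic with the Cantor pairing *)

Lemma cexec_to c s s1 s2 : cexec c s s1 -> s1 = s2 -> cexec c s s2.
Proof. intros H <-; exact H. Qed.

(** [F i] is the state after [i] rounds; the arithmetic loops below are verified by giving it in
    closed form. *)
Lemma cexec_while_iter x c (F : nat -> nat -> nat) n s s' :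
  s = F 0 -> (forall i, i < n -> F i x <> 0 /\ cexec c (F i) (F (S i))) ->
  F n x = 0 -> s' = F n -> cexec (CWhile x c) s s'.
Proof.
  intros -> H Hn ->; revert F H Hn.
  induction n as [|n IH]; intros F H Hn.
  - apply cexec_while_end, Hn.
  - destruct (H 0 ltac:(lia)) as [H0 Hc].
    eapply cexec_while_step; [exact H0 | exact Hc |].
    apply (IH (fun i => F (S i))); [|exact Hn].
    intros i Hi; apply (H (S i)); lia.
Qed.

Ltac upd_cases :=
  unfold upd in *;
  repeat match goal with |- context [Nat.eqb ?u ?v] =>
    destruct (Nat.eqb_spec u v) end;
  subst; try congruence; try lia.
Ltac state_eq := apply functional_extensionality; intros ?z; upd_cases.

Definition cclear (x : nat) : cmd := CWhile x (CDec x).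
Definition cmove (x y : nat) : cmd := CWhile x (CDec x;; CInc y).
(** Reading a counter destroys it, so a copy is made by moving to two targets and then moving one of
    them back. *)
Definition cmove2 (x y z : nat) : cmd := CWhile x (CDec x;; CInc y;; CInc z).

Lemma cclear_spec x s : cexec (cclear x) s (upd s x 0).
Proof.
  apply (cexec_while_iter _ _ (fun i => upd s x (s x - i)) (s x)).
  - state_eq.
  - intros i Hi; split; [upd_cases |].
    eapply cexec_to; [apply cexec_dec; upd_cases | state_eq].
  - upd_cases.
  - state_eq.
Qed.

Lemma cmove_spec x y s : x <> y ->
  cexec (cmove x y) s (upd (upd s y (s y + s x)) x 0).
Proof.
  intros Hxy.
  apply (cexec_while_iter _ _ (fun i => upd (upd s y (s y + i)) x (s x - i)) (s x)).
  - state_eq.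
  - intros i Hi; split; [upd_cases |].
    eapply cexec_to; [eapply cexec_seq; [apply cexec_dec; upd_cases |
      apply cexec_inc] | state_eq].
  - upd_cases.
  - state_eq.
Qed.

Lemma cmove2_spec x y z s : x <> y -> x <> z -> y <> z ->
  cexec (cmove2 x y z) s
    (upd (upd (upd s z (s z + s x)) y (s y + s x)) x 0).
Proof.
  intros Hxy Hxz Hyz.
  apply (cexec_while_iter _ _
    (fun i => upd (upd (upd s z (s z + i)) y (s y + i)) x (s x - i)) (s x)).
  - state_eq.
  - intros i Hi; split; [upd_cases |].
    eapply cexec_to; [eapply cexec_seq; [apply cexec_dec; upd_cases |
      eapply cexec_seq; apply cexec_inc] | state_eq].
  - upd_cases.
  - state_eq.
Qed.

(** The successor reserves 0 for [Leaf], so that branching on a tree becomes a zero test. *)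
Definition cons_code (m n : nat) : nat := S (Cantor.to_nat (m, n)).
Definition head_code (n : nat) : nat :=
  match n with 0 => 0 | S n => fst (Cantor.of_nat n) end.
Definition tail_code (n : nat) : nat :=
  match n with 0 => 0 | S n => snd (Cantor.of_nat n) end.

Lemma head_cons m n : head_code (cons_code m n) = m.
Proof. unfold head_code, cons_code; rewrite cancel_of_to; reflexivity. Qed.

Lemma tail_cons m n : tail_code (cons_code m n) = n.
Proof. unfold tail_code, cons_code; rewrite cancel_of_to; reflexivity. Qed.

Section Pairing.

Variables (a b n t : nat).
Hypotheses (ab : a <> b) (an : a <> n) (at_ : a <> t) (bn : b <> n)
  (bt : b <> t) (nt : n <> t).

Let triangle (m : nat) : nat := Cantor.to_nat (m, 0).

(* Computes [1 + y + (1 + ... + (x + y))] from the values [x] of [a] and [y]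
   of [b]. *)
Definition cpair : cmd :=
  cmove2 b a n;; CInc n;;
  CWhile a (CDec a;; CInc n;; cmove2 a n t;; cmove t a);;
  cmove n a.

Lemma cpair_spec s : s n = 0 -> s t = 0 ->
  cexec cpair s (upd (upd s b 0) a (cons_code (s a) (s b))).
Proof using ab an at_ bn bt nt.
  intros Hn Ht.
  assert (HT : forall m, triangle (S m) = S m + triangle m)
    by (intros m; unfold triangle; simpl; reflexivity).
  assert (HM : forall m j, j <= m -> triangle j <= triangle m).
  { intros m j Hj; induction Hj as [|m Hj IH]; [lia |].
    rewrite HT; clear - IH; lia. }
  assert (HC : cons_code (s a) (s b) = S (s b + triangle (s a + s b))).
  { unfold cons_code, triangle, Cantor.to_nat; simpl.
    rewrite (Nat.add_comm (s b) (s a)); lia. }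
  rewrite HC; generalize (eq_refl (s a + s b)).
  generalize (s a + s b) at 2 3; intros w Hw.
  eapply cexec_seq; [apply cmove2_spec; congruence |].
  eapply cexec_seq; [apply cexec_inc |].
  eapply cexec_seq.
  (* [triangle m] is 1 + ... + m; after [i] rounds its [i] largest terms for m = w have been added
     to [n]. *)
  - apply (cexec_while_iter _ _ (fun i => upd (upd (upd s b 0) a (w - i)) n
      (S (s b + (triangle w - triangle (w - i))))) w).
    + state_eq; rewrite Nat.sub_0_r; lia.
    + intros i Hi; split; [upd_cases |].
      assert (E : triangle (w - i) = w - i + triangle (w - S i)).
      { replace (w - i) with (S (w - S i)) by lia; apply HT. }
      assert (HM1 := HM w (w - i) ltac:(lia)).
      eapply cexec_to.
      * eapply cexec_seq; [apply cexec_dec; upd_cases |].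
        eapply cexec_seq; [apply cexec_inc |].
        eapply cexec_seq; [apply cmove2_spec; congruence |].
        apply cmove_spec; congruence.
      * state_eq.
    + upd_cases.
    + reflexivity.
  - eapply cexec_to; [apply cmove_spec; congruence |].
    state_eq; rewrite Nat.sub_diag; change (triangle 0) with 0; lia.
Qed.

End Pairing.

Section Unpairing.

Variables (a b n : nat).
Hypotheses (ab : a <> b) (an : a <> n) (bn : b <> n).

(** Walks along the diagonals of the Cantor enumeration: [(S x, y)] is followed by [(x, S y)], and
    [(0, y)] by [(S y, 0)]. No triangular root has to be computed. *)
Definition cunpair : cmd :=
  CIf n (CDec n;;
    CWhile n (CDec n;;
      CIf a (CDec a;; CInc b) (cmove b a;; CInc a))) CSkip.

Lemma cunpair_spec s : s a = 0 -> s b = 0 ->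
  cexec cunpair s
    (upd (upd (upd s b (tail_code (s n))) a (head_code (s n))) n 0).
Proof using ab an bn.
  intros Ha Hb.
  destruct (s n) as [|m] eqn:Hn.
  - apply cexec_if_false; [exact Hn |].
    eapply cexec_to; [apply cexec_skip | simpl; state_eq].
  - apply cexec_if_true; [lia |].
    eapply cexec_seq; [apply cexec_dec; lia |].
    apply (cexec_while_iter _ _ (fun i =>
      upd (upd (upd s b (snd (Cantor.of_nat i))) a (fst (Cantor.of_nat i)))
        n (m - i)) m).
    + simpl; state_eq.
    + intros i Hi; split; [upd_cases |].
      eapply cexec_seq; [apply cexec_dec; upd_cases |].
      change (Cantor.of_nat (S i)) with
        (match Cantor.of_nat i with (0, y) => (S y, 0) | (S x, y) => (x, S y) end).
      destruct (Cantor.of_nat i) as [[|x] y]; simpl fst; simpl snd.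
      * apply cexec_if_false; [upd_cases |].
        eapply cexec_to; [eapply cexec_seq; [apply cmove_spec; congruence |
          apply cexec_inc] | state_eq].
      * apply cexec_if_true; [upd_cases |].
        eapply cexec_to; [eapply cexec_seq; [apply cexec_dec; upd_cases |
          apply cexec_inc] | state_eq].
    + upd_cases.
    + simpl head_code; simpl tail_code; state_eq.
Qed.

End Unpairing.

(** * Tree expressions evaluated on counters *)

Inductive expr : Set :=
  | ENil
  | EVar (x : nat)
  | ECons (e1 e2 : expr)
  | EHead (e : expr)
  | ETail (e : expr).

Fixpoint eval (e : expr) (s : nat -> nat) : nat :=
  match e with
  | ENil => 0
  | EVar x => s x
  | ECons e1 e2 => cons_code (eval e1 s) (eval e2 s)
  | EHead e => head_code (eval e s)
  | ETail e => tail_code (eval e s)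
  end.

(* Program variables live in the even counters; the odd ones form a stack for
   intermediate results. *)
Definition vreg (x : nat) : nat := 2 * x.
Definition stk (d : nat) : nat := S (2 * d).

Fixpoint cexpr (e : expr) (d : nat) : cmd :=
  match e with
  | ENil => CSkip
  | EVar x =>
      cmove2 (vreg x) (stk d) (stk (S d));; cmove (stk (S d)) (vreg x)
  | ECons e1 e2 =>
      cexpr e1 d;; cexpr e2 (S d);;
      cpair (stk d) (stk (S d)) (stk (S (S d))) (stk (S (S (S d))))
  | EHead e =>
      cexpr e d;; cunpair (stk (S d)) (stk (S (S d))) (stk d);;
      cclear (stk (S (S d)));; cmove (stk (S d)) (stk d)
  | ETail e =>
      cexpr e d;; cunpair (stk (S d)) (stk (S (S d))) (stk d);;
      cclear (stk (S d));; cmove (stk (S (S d))) (stk d)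
  end.

Lemma cexpr_spec e d s : (forall j, d <= j -> s (stk j) = 0) ->
  cexec (cexpr e d) s (upd s (stk d) (eval e (fun x => s (vreg x)))).
Proof.
  revert d s; induction e as [|x|e1 IH1 e2 IH2|e IH|e IH]; intros d s Hs; simpl;
    assert (H0 := Hs d ltac:(lia)); assert (H1 := Hs (S d) ltac:(lia));
    assert (H2 := Hs (S (S d)) ltac:(lia));
    assert (H3 := Hs (S (S (S d))) ltac:(lia)).
  - eapply cexec_to; [apply cexec_skip | state_eq].
  - eapply cexec_to; [eapply cexec_seq; [apply cmove2_spec | apply cmove_spec] |];
      try (unfold stk, vreg; lia).
    unfold stk, vreg in *; state_eq.
  - assert (Hv : forall d v, (fun x => upd s (stk d) v (vreg x))
                             = (fun x => s (vreg x))).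
    { intros; apply functional_extensionality; intros; unfold stk, vreg; upd_cases. }
    eapply cexec_seq; [apply IH1, Hs |].
    eapply cexec_seq.
    + apply IH2; intros j Hj; assert (Hsj := Hs j ltac:(lia)).
      unfold stk in *; upd_cases.
    + rewrite Hv; eapply cexec_to; [apply cpair_spec |];
        try (unfold stk in *; upd_cases; fail).
      unfold stk in *; state_eq; try (f_equal; upd_cases).
  - eapply cexec_seq; [apply IH, Hs |].
    eapply cexec_to; [eapply cexec_seq; [apply cunpair_spec |
      eapply cexec_seq; [apply cclear_spec | apply cmove_spec]] |];
      try (unfold stk in *; upd_cases; fail).
    unfold stk in *; state_eq.
  - eapply cexec_seq; [apply IH, Hs |].
    eapply cexec_to; [eapply cexec_seq; [apply cunpair_spec |
      eapply cexec_seq; [apply cclear_spec | apply cmove_spec]] |];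
      try (unfold stk in *; upd_cases; fail).
    unfold stk in *; state_eq.
Qed.

(** The value is completed on the stack before [x] is cleared, so [e] may mention [x]. *)
Definition cassign (x : nat) (e : expr) : cmd :=
  cexpr e 0;; cclear (vreg x);; cmove (stk 0) (vreg x).

(** With the stack empty between assignments, a valuation of the program variables describes all
    counters. *)
Definition store (s : nat -> nat) : nat -> nat :=
  fun i => if Nat.even i then s (Nat.div2 i) else 0.

Lemma store_vreg s x : store s (vreg x) = s x.
Proof.
  unfold store, vreg; rewrite Nat.even_mul; simpl Nat.even; simpl orb; cbv iota.
  rewrite Nat.div2_double; reflexivity.
Qed.

Lemma store_stk s d : store s (stk d) = 0.
Proof.
  unfold store, stk; rewrite Nat.even_succ, Nat.odd_mul; reflexivity.
Qed.

Lemma vreg_or_stk i : (exists x, i = vreg x) \/ (exists d, i = stk d).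
Proof.
  unfold vreg, stk; destruct (Nat.Even_or_Odd i) as [[x ->]|[x ->]]; eauto.
  right; exists x; lia.
Qed.

Lemma upd_store s x v : upd (store s) (vreg x) v = store (upd s x v).
Proof.
  apply functional_extensionality; intros i.
  destruct (vreg_or_stk i) as [[y ->]|[d ->]].
  - rewrite store_vreg; unfold upd.
    destruct (Nat.eqb_spec (vreg y) (vreg x)), (Nat.eqb_spec y x);
      rewrite ?store_vreg; unfold vreg in *; auto; lia.
  - rewrite store_stk; unfold upd.
    destruct (Nat.eqb_spec (stk d) (vreg x)); [unfold stk, vreg in *; lia |].
    apply store_stk.
Qed.

Lemma cassign_spec x e s :
  cexec (cassign x e) (store s) (store (upd s x (eval e s))).
Proof.
  assert (E : (fun x => store s (vreg x)) = s)
    by (apply functional_extensionality; apply store_vreg).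
  eapply cexec_seq; [apply cexpr_spec; intros; apply store_stk |].
  rewrite E, <- upd_store.
  eapply cexec_to; [eapply cexec_seq; [apply cclear_spec | apply cmove_spec] |].
  - unfold stk, vreg; lia.
  - assert (H := store_stk s 0); unfold stk, vreg in *; state_eq.
Qed.

Lemma cdec_spec x n s :
  s x = S n -> cexec (CDec (vreg x)) (store s) (store (upd s x n)).
Proof.
  intros H; rewrite <- upd_store; eapply cexec_to; [apply cexec_dec |];
    rewrite store_vreg, H; [discriminate | reflexivity].
Qed.

(** * Simulation of programs up to their first output *)

Opaque cons_code.

Fixpoint code (t : tree) : nat :=
  match t with Leaf => 0 | Node t u => cons_code (code t) (code u) end.

Lemma head_code_correct t : head_code (code t) = code (head t).
Proof. destruct t; [reflexivity | apply head_cons]. Qed.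

Lemma tail_code_correct t : tail_code (code t) = code (tail t).
Proof. destruct t; [reflexivity | apply tail_cons]. Qed.

Lemma cons_code_neq_0 m n : cons_code m n <> 0.
Proof. Transparent cons_code. discriminate. Opaque cons_code. Qed.

(* The variables below 20 are reserved for bookkeeping. *)
Definition v_pc := 0.
Definition v_run := 1.
Definition v_verdict := 2.
Definition v_self := 3.
Definition v_reg (x : nat) := 20 + x.

(** Increments suffice because [cswitch] has counted the program counter down to 0 before an
    instruction is executed. *)
Definition cset_pc (l : nat) : cmd :=
  Nat.iter l (fun c => CInc (vreg v_pc);; c) CSkip.

(** Of a printed message only the head, the number of its constructor, is kept; clearing [v_run]
    ends the simulation there. *)
Definition cinstr (pc : nat) (i : instr) : cmd :=
  let assign x e := cassign (v_reg x) e;; cset_pc (S pc) in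
  match i with
  | INil x => assign x ENil
  | ICopy x y => assign x (EVar (v_reg y))
  | ICons x y z => assign x (ECons (EVar (v_reg y)) (EVar (v_reg z)))
  | IHead x y => assign x (EHead (EVar (v_reg y)))
  | ITail x y => assign x (ETail (EVar (v_reg y)))
  | IBranch x l1 l2 => CIf (vreg (v_reg x)) (cset_pc l1) (cset_pc l2)
  | IPrint x =>
      cassign v_verdict (EHead (EVar (v_reg x)));; cassign v_run ENil
  end.

Fixpoint cswitch (p : program) (pc : nat) : cmd :=
  match p with
  | [] => CSkip
  | i :: p =>
      CIf (vreg v_pc) (CDec (vreg v_pc);; cswitch p (S pc)) (cinstr pc i)
  end.

Definition csimulate (p : program) : cmd := CWhile (vreg v_run) (cswitch p 0).

Definition simulates (s : nat -> nat) (c : config) : Prop :=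
  s v_pc = cf_pc c /\ s v_run <> 0 /\ forall x, s (v_reg x) = code (cf_reg c x).

Lemma cset_pc_spec l s :
  cexec (cset_pc l) (store s) (store (upd s v_pc (s v_pc + l))).
Proof.
  revert s; induction l as [|l IH]; intros s; simpl.
  - eapply cexec_to; [apply cexec_skip |].
    f_equal; state_eq.
  - eapply cexec_seq; [apply cexec_inc |].
    rewrite upd_store, store_vreg; eapply cexec_to; [apply IH |].
    f_equal; state_eq.
Qed.

Lemma cswitch_spec p pc i s s' :
  nth_error p (s v_pc) = Some i ->
  cexec (cinstr (pc + s v_pc) i) (store (upd s v_pc 0)) s' ->
  cexec (cswitch p pc) (store s) s'.
Proof.
  revert pc s; induction p as [|j p IH]; intros pc s Hi H.
  - destruct (s v_pc); discriminate.
  - simpl; destruct (s v_pc) as [|n] eqn:E.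
    + injection Hi as <-; apply cexec_if_false; [rewrite store_vreg; exact E |].
      rewrite Nat.add_0_r in H.
      replace (upd s v_pc 0) with s in H by state_eq; exact H.
    + apply cexec_if_true; [rewrite store_vreg, E; discriminate |].
      eapply cexec_seq; [apply (cdec_spec _ n), E |].
      assert (En : upd s v_pc n v_pc = n) by upd_cases.
      apply IH; rewrite En; [exact Hi |].
      replace (upd (upd s v_pc n) v_pc 0) with (upd s v_pc 0) by state_eq.
      rewrite Nat.add_succ_comm; exact H.
Qed.

Lemma cinstr_step i c s :
  simulates s c -> (forall x, i <> IPrint x) ->
  exists s', cexec (cinstr (cf_pc c) i) (store (upd s v_pc 0)) (store s') /\
    simulates s' (exec i c).
Proof.
  destruct c as [pc r out]; intros (Hpc & Hrun & Hreg) Hi; simpl cf_pc in *.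
  simpl cf_reg in Hreg.
  assert (HA : forall x e u, eval e (upd s v_pc 0) = code u ->
    exists s', cexec (cassign (v_reg x) e;; cset_pc (S pc))
                 (store (upd s v_pc 0)) (store s') /\
      simulates s' (Config (S pc) (update r x u) out)).
  { intros x e u He; eexists; split.
    - eapply cexec_seq; [apply cassign_spec | apply cset_pc_spec].
    - rewrite He; split; [reflexivity | split; [exact Hrun |]].
      intros z; unfold update, upd; simpl cf_reg.
      change (Nat.eqb (v_reg z) v_pc) with false; cbv iota.
      change (Nat.eqb (v_reg z) (v_reg x)) with (Nat.eqb z x).
      destruct (Nat.eqb z x); [reflexivity | apply Hreg]. }
  assert (HR : forall x, upd s v_pc 0 (v_reg x) = code (r x)) by exact Hreg.
  destruct i as [x|x y|x y z|x y|x y|x l1 l2|x]; simpl.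
  - apply HA; reflexivity.
  - apply HA; apply HR.
  - apply HA; simpl; rewrite !HR; reflexivity.
  - apply HA; simpl; rewrite HR; apply head_code_correct.
  - apply HA; simpl; rewrite HR; apply tail_code_correct.
  - eexists (upd s v_pc (match r x with Leaf => l2 | Node _ _ => l1 end)).
    split; [|split; [reflexivity | split; [exact Hrun | exact Hreg]]].
    assert (HS : forall l, cexec (cset_pc l) (store (upd s v_pc 0))
                             (store (upd s v_pc l))).
    { intros l; eapply cexec_to; [apply cset_pc_spec |]; f_equal; state_eq. }
    destruct (r x) as [|u v] eqn:E.
    + apply cexec_if_false; [rewrite store_vreg, HR, E; reflexivity | apply HS].
    + apply cexec_if_true; [|apply HS].
      rewrite store_vreg, HR, E; apply cons_code_neq_0.
  - destruct (Hi x eq_refl).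
Qed.

Fixpoint prints_first (p : program) (n : nat) (c : config) (t : tree) : Prop :=
  match n with
  | 0 => exists x, nth_error p (cf_pc c) = Some (IPrint x) /\ cf_reg c x = t
  | S n => (exists i, nth_error p (cf_pc c) = Some i /\ forall x, i <> IPrint x)
           /\ prints_first p n (step p c) t
  end.

Lemma csimulate_spec p n c t s :
  prints_first p n c t -> simulates s c ->
  exists s', cexec (csimulate p) (store s) (store s') /\
    s' v_verdict = code (head t).
Proof.
  revert c s; induction n as [|n IH]; intros c s Hp Hs.
  - destruct Hp as (x & Hi & Ht), Hs as (Hpc & Hrun & Hreg).
    eexists; split.
    + eapply cexec_while_step; [rewrite store_vreg; exact Hrun | |].
      * eapply cswitch_spec; [rewrite Hpc; exact Hi |].
        eapply cexec_seq; apply cassign_spec.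
      * apply cexec_while_end; rewrite store_vreg; reflexivity.
    + rewrite <- Ht, <- head_code_correct, <- Hreg; reflexivity.
  - destruct Hp as ((i & Hi & Hn) & Hp).
    destruct (cinstr_step i c s Hs Hn) as (s1 & H1 & Hs1).
    unfold step in Hp; rewrite Hi in Hp.
    destruct (IH _ _ Hp Hs1) as (s' & H' & Hv).
    exists s'; split; [|exact Hv].
    destruct Hs as (Hpc & Hrun & _).
    eapply cexec_while_step; [rewrite store_vreg; exact Hrun | | exact H'].
    eapply cswitch_spec; rewrite Hpc; [exact Hi | exact H1].
Qed.

Lemma iter_step_output p k c :
  exists l, cf_output (Nat.iter k (step p) c) = cf_output c ++ l.
Proof.
  induction k as [|k [l IH]]; simpl.
  - exists []; rewrite app_nil_r; reflexivity.
  - destruct (Nat.iter k (step p) c) as [pc r out]; simpl in IH; subst out.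
    unfold step; simpl cf_pc.
    destruct (nth_error p pc) as [[]|]; simpl; eauto.
    rewrite <- app_assoc; eauto.
Qed.

Lemma output_prints_first p k c t l :
  cf_output c = [] -> cf_output (Nat.iter k (step p) c) = t :: l ->
  exists n, prints_first p n c t.
Proof.
  revert c; induction k as [|k IH]; intros c Hc H.
  - simpl in H; congruence.
  - rewrite Nat.iter_succ_r in H.
    destruct (nth_error p (cf_pc c)) as [i|] eqn:E.
    + destruct (classic (exists x, i = IPrint x)) as [[x ->]|Hi].
      * exists 0, x; split; [exact E|].
        destruct (iter_step_output p k (step p c)) as [l' Hl'].
        rewrite H in Hl'; unfold step in Hl'; rewrite E in Hl'.
        destruct c; simpl in Hc, Hl'; subst; injection Hl'; auto.
      * assert (Hs : cf_output (step p c) = []).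
        { unfold step; rewrite E; destruct c; simpl in *; subst.
          destruct i; simpl; auto; destruct Hi; eauto. }
        destruct (IH _ Hs H) as [n Hn].
        exists (S n); split; [|exact Hn].
        exists i; split; [exact E | intros x Hx; eauto].
    (* A halted program stays put, so the print still lies ahead of the same configuration. *)
    + apply IH; [exact Hc|].
      replace (step p c) with c in H by (unfold step; rewrite E; reflexivity).
      exact H.
Qed.

(** * The self-referential input *)

Definition v_count1 := 4.
Definition v_count2 := 5.
Definition v_qspaces := 6.
Definition v_state := 7.
Definition v_constraints := 8.
Definition v_trigger1 := 9.
Definition v_trigger2 := 10.
Definition v_inherit := 11.
Definition v_address := 12.
Definition v_prefix := 13.
Definition v_start := 14.
Definition v_regions := 15.

Ltac store_eq :=
  f_equal; simpl eval;
  cbv delta [v_pc v_run v_verdict v_self v_reg v_count1 v_count2 v_qspaces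
    v_state v_constraints v_trigger1 v_trigger2 v_inherit v_address v_prefix
    v_start v_regions] in *; state_eq.

Definition elist : list expr -> expr := fold_right ECons ENil.
(** All the records to be built have constructor number 0, encoded by [Leaf]; hence [ENil]. *)
Definition econstr (l : list expr) : expr := ECons ENil (elist l).

Definition echain_transition (trigger : nat) : expr :=
  econstr [EVar trigger; EVar v_address; EVar v_inherit; EVar v_inherit; ENil].
(** One template serves the whole chain, since its regions differ only in the address they jump
    to. *)
Definition echain_region : expr :=
  econstr [EVar v_constraints;
           elist [echain_transition v_trigger1; echain_transition v_trigger2]].
Definition einput : expr :=
  econstr [econstr [EVar v_qspaces; EVar v_regions]; EVar v_start; EVar v_state].

Definition cunpack (x : nat) : cmd :=
  cassign x (EHead (EVar v_self));; cassign v_self (ETail (EVar v_self)).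
Definition cpush (x : nat) (e : expr) : cmd := cassign x (ECons e (EVar x)).
Definition cpop (x : nat) : cmd := cassign x (ETail (EVar x)).

(** Addresses are unary, so one [ECons ENil] per unit leads from the entry address to the start
    address. *)
Definition cascend : cmd :=
  CWhile (vreg v_count1) (CDec (vreg v_count1);; cpush v_address ENil).
(** A list grows at its front, so the chain is produced from its last region to its first, with the
    address counting down. *)
Definition cchain : cmd :=
  CWhile (vreg v_count2)
    (CDec (vreg v_count2);; cpop v_address;; cpush v_regions echain_region).
(** The regions of [base] are stored in reverse, so pushing them one by one restores their order. *)
Definition cprepend : cmd :=
  CWhile (vreg v_prefix)
    (cpush v_regions (EHead (EVar v_prefix));; cpop v_prefix).

(** Here the number in [v_self] plays both its roles: it is copied twice as the length of the chain,
    for the two loops to come, and then taken apart as data. *)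
Definition cload : cmd :=
  cassign v_count1 (EVar v_self);; cassign v_count2 (EVar v_self);;
  cunpack v_qspaces;; cunpack v_state;; cunpack v_constraints;;
  cunpack v_trigger1;; cunpack v_trigger2;; cunpack v_inherit;;
  cunpack v_address;; cassign v_prefix (EVar v_self).

Definition cbuild_input : cmd :=
  cload;; cascend;; cassign v_start (EVar v_address);;
  cchain;; cprepend;; cassign (v_reg 0) einput.

Definition cmain (p : program) : cmd :=
  cbuild_input;; cassign v_run (ECons ENil ENil);; csimulate p.

Lemma cunpack_spec x m n s : s v_self = cons_code m n ->
  cexec (cunpack x) (store s) (store (upd (upd s x m) v_self
    (if Nat.eqb v_self x then tail_code m else n))).
Proof.
  intros H; eapply cexec_to; [eapply cexec_seq; apply cassign_spec |].
  cbn [eval]; rewrite H, head_cons; do 2 f_equal; unfold upd.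
  destruct (Nat.eqb v_self x); [|rewrite H, tail_cons]; reflexivity.
Qed.

Lemma cload_spec n1 n2 n3 n4 n5 n6 n7 n8 s :
  s v_self = cons_code n1 (cons_code n2 (cons_code n3 (cons_code n4
    (cons_code n5 (cons_code n6 (cons_code n7 n8)))))) ->
  exists s', cexec cload (store s) (store s') /\
    s' v_count1 = s v_self /\ s' v_count2 = s v_self /\
    s' v_qspaces = n1 /\ s' v_state = n2 /\ s' v_constraints = n3 /\
    s' v_trigger1 = n4 /\ s' v_trigger2 = n5 /\ s' v_inherit = n6 /\
    s' v_address = n7 /\ s' v_prefix = n8 /\
    forall x, x = v_pc \/ v_prefix < x -> s' x = s x.
Proof.
  intros H; eexists; split.
  - eapply cexec_seq; [apply cassign_spec |].
    eapply cexec_seq; [apply cassign_spec |].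
    do 7 (eapply cexec_seq; [apply cunpack_spec; first [exact H | reflexivity] |]).
    apply cassign_spec.
  - repeat split; intros x Hx; unfold upd;
      repeat match goal with |- context [Nat.eqb x ?v] =>
        destruct (Nat.eqb_spec x v) as [E|_];
          [subst x; cbv in Hx; exfalso; lia |] end; reflexivity.
Qed.

Lemma iter_cons_nat n m :
  Nat.iter n (cons_code 0) (code (enc_nat m)) = code (enc_nat (m + n)).
Proof.
  induction n as [|n IH]; simpl; [rewrite Nat.add_0_r; reflexivity |].
  rewrite IH, Nat.add_succ_r; reflexivity.
Qed.

Lemma cascend_spec n s :
  s v_count1 = n ->
  cexec cascend (store s) (store (upd (upd s v_address
    (Nat.iter n (cons_code 0) (s v_address))) v_count1 0)).
Proof.
  revert s; induction n as [|n IH]; intros s Hn.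
  - eapply cexec_to; [apply cexec_while_end; rewrite store_vreg; exact Hn |].
    simpl Nat.iter; store_eq.
  - eapply cexec_while_step; [rewrite store_vreg, Hn; discriminate | |].
    + eapply cexec_seq; [apply (cdec_spec _ n), Hn | apply cassign_spec].
    + eapply cexec_to; [apply IH; reflexivity |].
      rewrite Nat.iter_succ_r; store_eq.
Qed.

Section Quine.

Variable p : program.

Definition exit_address : nat := csize (cmain p).
(** The last address of [base], after the verdict test, the endless loop and [Bad]; the instruction
    there jumps to the start of the program, and the chain runs down to it. *)
Definition entry_address : nat := 3 + exit_address.

(* At the exit, a verdict other than 0 leads to [Bad]. *)
Definition base : list minstr :=
  compile (cmain p) 0 ++
  [Move Keep (vreg v_verdict) (1 + exit_address) (2 + exit_address);
   Move Keep 0 (1 + exit_address) (1 + exit_address);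
   Bad;
   Move Keep 0 0 0].

Definition tested (a : minstr) : nat :=
  match a with Move _ y _ _ => y | Bad => 0 end.
(** A counter influences the run only by being tested, so the tested ones determine how many
    variables the model needs. *)
Definition bound : nat := S (list_max (map tested base)).

Definition chain_instr (i : nat) : minstr :=
  Move (Up (vreg v_self)) 0 (entry_address + i) (entry_address + i).

(** Not circular: [base] and [bound] depend on [p] alone, and the chain enters only through the
    parts common to its regions. *)
Definition self : tree :=
  Node (enc_list enc_qspace (repeat line (5 + bound)))
  (Node (enc_state (initial_state bound))
  (Node (enc_list enc_constraint (move_constraints bound (Up (vreg v_self))))
  (Node (enc_trigger (jump_zero 0))
  (Node (enc_trigger (jump_nonzero 0))
  (Node (enc_list enc_nat (seq 0 (5 + bound)))
  (Node (enc_nat entry_address)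
  (enc_list enc_region (rev (map (instr_region bound) base))))))))).

(* The chain of increments raises [v_self] from 0 to [code self], from which
   [cbuild_input] recovers the encoding of the whole input. *)
Definition machine : list minstr :=
  base ++ map chain_instr (seq 0 (code self)).
Definition start_address : nat := entry_address + code self.
Definition self_input : input := machine_input bound machine start_address.

Definition chain_store (s : nat -> nat) : Prop :=
  s v_constraints = code (enc_list enc_constraint
    (move_constraints bound (Up (vreg v_self)))) /\
  s v_trigger1 = code (enc_trigger (jump_zero 0)) /\
  s v_trigger2 = code (enc_trigger (jump_nonzero 0)) /\
  s v_inherit = code (enc_list enc_nat (seq 0 (5 + bound))).

Lemma cchain_spec n s l :
  chain_store s -> s v_count2 = n ->
  s v_address = code (enc_nat (entry_address + n)) ->
  s v_regions = code (enc_list enc_region l) ->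
  cexec cchain (store s)
    (store (upd (upd (upd s v_address (code (enc_nat entry_address)))
      v_regions (code (enc_list enc_region
        (map (instr_region bound) (map chain_instr (seq 0 n)) ++ l))))
      v_count2 0)).
Proof.
  revert s l; induction n as [|n IH]; intros s l Hs Hn Ha Hl.
  - eapply cexec_to; [apply cexec_while_end; rewrite store_vreg; exact Hn |].
    rewrite Nat.add_0_r in Ha; simpl app; store_eq.
  - eapply cexec_while_step; [rewrite store_vreg, Hn; discriminate | |].
    + eapply cexec_seq; [apply (cdec_spec _ n), Hn |].
      eapply cexec_seq; apply cassign_spec.
    + set (s1 := upd s v_count2 n).
      assert (H1 : eval (ETail (EVar v_address)) s1
                   = code (enc_nat (entry_address + n))).
      { simpl; change (s1 v_address) with (s v_address).
        rewrite Ha, Nat.add_succ_r; apply tail_cons. }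
      rewrite H1; set (s2 := upd s1 v_address _).
      assert (H2 : eval (ECons echain_region (EVar v_regions)) s2
        = code (enc_list enc_region (instr_region bound (chain_instr n) :: l))).
      { destruct Hs as (E1 & E2 & E3 & E4).
        simpl eval.
        change (s2 v_constraints) with (s v_constraints).
        change (s2 v_trigger1) with (s v_trigger1).
        change (s2 v_trigger2) with (s v_trigger2).
        change (s2 v_inherit) with (s v_inherit).
        change (s2 v_regions) with (s v_regions).
        change (s2 v_address) with (code (enc_nat (entry_address + n))).
        rewrite E1, E2, E3, E4, Hl; reflexivity. }
      rewrite H2.
      eapply cexec_to; [apply (IH _ (instr_region bound (chain_instr n) :: l));
        [exact Hs | reflexivity | reflexivity | reflexivity] |].
      assert (EA : map (instr_region bound) (map chain_instr (seq 0 (S n))) ++ l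
        = map (instr_region bound) (map chain_instr (seq 0 n))
          ++ instr_region bound (chain_instr n) :: l)
        by (rewrite seq_S, !map_app, <- app_assoc; reflexivity).
      rewrite EA; subst s2 s1; store_eq.
Qed.

Lemma cprepend_spec (l m : list region) s :
  s v_prefix = code (enc_list enc_region l) ->
  s v_regions = code (enc_list enc_region m) ->
  cexec cprepend (store s)
    (store (upd (upd s v_regions (code (enc_list enc_region (rev l ++ m))))
      v_prefix 0)).
Proof.
  revert m s; induction l as [|r l IH]; intros m s Hl Hm.
  - eapply cexec_to; [apply cexec_while_end; rewrite store_vreg; exact Hl |].
    simpl app; simpl in Hl; store_eq.
  - eapply cexec_while_step.
    + rewrite store_vreg, Hl; apply cons_code_neq_0.
    + eapply cexec_seq; apply cassign_spec.
    + assert (H1 : eval (ECons (EHead (EVar v_prefix)) (EVar v_regions)) s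
        = code (enc_list enc_region (r :: m))).
      { simpl; rewrite Hl, Hm; simpl; rewrite head_cons; reflexivity. }
      rewrite H1; set (s1 := upd s v_regions _).
      assert (H2 : eval (ETail (EVar v_prefix)) s1 = code (enc_list enc_region l)).
      { simpl; change (s1 v_prefix) with (s v_prefix).
        rewrite Hl; apply tail_cons. }
      rewrite H2; simpl rev; rewrite <- app_assoc; change ([r] ++ m) with (r :: m).
      eapply cexec_to; [apply (IH (r :: m)); reflexivity |].
      subst s1; store_eq.
Qed.

Definition initial_store : nat -> nat := upd (fun _ => 0) v_self (code self).

Lemma cbuild_input_spec : exists s,
  cexec cbuild_input (store initial_store) (store s) /\ s v_pc = 0 /\
  s (v_reg 0) = code (enc_input self_input) /\ forall x, s (v_reg (S x)) = 0.
Proof.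
  destruct (cload_spec
    (code (enc_list enc_qspace (repeat line (5 + bound))))
    (code (enc_state (initial_state bound)))
    (code (enc_list enc_constraint (move_constraints bound (Up (vreg v_self)))))
    (code (enc_trigger (jump_zero 0)))
    (code (enc_trigger (jump_nonzero 0)))
    (code (enc_list enc_nat (seq 0 (5 + bound))))
    (code (enc_nat entry_address))
    (code (enc_list enc_region (rev (map (instr_region bound) base))))
    initial_store eq_refl)
    as (s1 & H1 & Ec1 & Ec2 & Eq & Es & Ek & E1 & E2 & Ei & Ea & Ep & Ex).
  assert (Hself : initial_store v_self = code self) by reflexivity.
  rewrite Hself in Ec1, Ec2; clear Hself.
  assert (Er : s1 v_regions = 0) by (rewrite Ex; [reflexivity | cbv; lia]).
  assert (Epc : s1 v_pc = 0) by (rewrite Ex; [reflexivity | auto]).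
  assert (Ereg : forall x, s1 (v_reg x) = 0)
    by (intros x; rewrite Ex; [reflexivity | unfold v_reg, v_prefix; lia]).
  assert (H2 := cascend_spec _ s1 Ec1).
  rewrite Ea, iter_cons_nat in H2.
  set (s2 := upd _ v_count1 0) in H2.
  assert (H3 := cassign_spec v_start (EVar v_address) s2).
  change (eval (EVar v_address) s2)
    with (code (enc_nat (entry_address + code self))) in H3.
  set (s3 := upd s2 _ _) in H3.
  assert (H4 := cchain_spec (code self) s3 []
    (conj Ek (conj E1 (conj E2 Ei))) Ec2 eq_refl Er).
  rewrite app_nil_r in H4; set (s4 := upd _ v_count2 0) in H4.
  assert (H5 := cprepend_spec _ _ s4 Ep eq_refl).
  rewrite rev_involutive, <- map_app in H5; fold machine in H5.
  set (s5 := upd _ v_prefix 0) in H5.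
  assert (E : eval einput s5 = code (enc_input self_input)).
  { assert (F1 : s5 v_qspaces = s1 v_qspaces) by reflexivity.
    assert (F2 : s5 v_state = s1 v_state) by reflexivity.
    assert (F3 : s5 v_regions
      = code (enc_list enc_region (map (instr_region bound) machine)))
      by reflexivity.
    assert (F4 : s5 v_start = code (enc_nat start_address)) by reflexivity.
    simpl eval; rewrite F1, F2, F3, F4, Eq, Es; reflexivity. }
  exists (upd s5 (v_reg 0) (eval einput s5)).
  split; [|split; [exact Epc | split; [exact E | exact (fun x => Ereg (S x))]]].
  eapply cexec_seq; [exact H1 |].
  eapply cexec_seq; [exact H2 |].
  eapply cexec_seq; [exact H3 |].
  eapply cexec_seq; [exact H4 |].
  eapply cexec_seq; [exact H5 | apply cassign_spec].
Qed.

Lemma cmain_spec n t :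
  prints_first p n (Config 0 (update (fun _ => Leaf) 0 (enc_input self_input)) [])
    t ->
  exists s, cexec (cmain p) (store initial_store) (store s) /\
    s v_verdict = code (head t).
Proof.
  intros H; destruct cbuild_input_spec as (s & Hs & Hpc & H0 & HS).
  destruct (csimulate_spec p n _ t (upd s v_run (cons_code 0 0)) H)
    as (s' & Hs' & Hv).
  - split; [exact Hpc | split; [apply cons_code_neq_0 |]].
    intros [|x]; [exact H0 | exact (HS x)].
  - exists s'; split; [|exact Hv].
    eapply cexec_seq; [exact Hs |].
    eapply cexec_seq; [apply cassign_spec | exact Hs'].
Qed.

Opaque cmain.

Lemma base_length : length base = S entry_address.
Proof.
  unfold base; rewrite length_app, compile_length.
  fold exit_address; cbn [length]; unfold entry_address; lia.
Qed.

Lemma Forall_lt_list_max l : Forall (fun n => n < S (list_max l)) l.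
Proof.
  eapply Forall_impl, (proj1 (list_max_le l _) (Nat.le_refl _)).
  intros n Hn; apply le_n_S, Hn.
Qed.

Lemma machine_ok :
  start_address < length machine /\
  Forall (minstr_ok bound (length machine)) machine.
Proof.
  assert (HL : length machine = S entry_address + code self).
  { unfold machine; rewrite length_app, base_length, length_map, length_seq.
    reflexivity. }
  split; [unfold start_address; lia |].
  assert (HJ : Forall (jumps_within (length machine)) machine).
  { unfold machine at 2, base; rewrite HL; unfold entry_address.
    rewrite !Forall_app; repeat split.
    - apply compile_jumps; fold exit_address; lia.
    - repeat apply Forall_cons; try apply Forall_nil; cbn [jumps_within];
        try exact I; lia.
    - apply Forall_map, Forall_forall; intros i Hi%in_seq.
      unfold chain_instr; cbn [jumps_within].
      unfold entry_address; lia. }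
  assert (HT : Forall (fun a => tested a < bound) machine).
  { unfold machine; apply Forall_app; split.
    - apply (Forall_map tested (fun y => y < bound)), Forall_lt_list_max.
    - apply Forall_map, Forall_forall; intros i _; apply Nat.lt_0_succ. }
  apply Forall_forall; intros a Ha.
  rewrite Forall_forall in HJ, HT; specialize (HJ a Ha); specialize (HT a Ha).
  destruct a; simpl in *; auto.
Qed.

Lemma machine_base i a :
  nth_error base i = Some a -> nth_error machine i = Some a.
Proof.
  intros H; unfold machine; rewrite nth_error_app1; [exact H |].
  apply nth_error_Some; congruence.
Qed.

Lemma exit_code i a :
  nth_error
    [Move Keep (vreg v_verdict) (1 + exit_address) (2 + exit_address);
     Move Keep 0 (1 + exit_address) (1 + exit_address);
     Bad; Move Keep 0 0 0] i = Some a ->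
  nth_error machine (exit_address + i) = Some a.
Proof.
  intros H; apply machine_base; unfold base.
  rewrite nth_error_app2; rewrite compile_length; fold exit_address; [|lia].
  replace (exit_address + i - exit_address) with i by lia; exact H.
Qed.

Lemma chain_run n m : n + m <= code self ->
  reaches machine (entry_address + n, counters_of (store (upd (fun _ => 0) v_self m)))
    (entry_address, counters_of (store (upd (fun _ => 0) v_self (m + n)))).
Proof.
  revert m; induction n as [|n IH]; intros m H.
  - rewrite !Nat.add_0_r; apply reaches_refl.
  - eapply reaches_trans; [apply (reaches_change _ _ (Up (vreg v_self)) 0
      (entry_address + n) _ (store (upd (fun _ => 0) v_self (S m)))) |].
    + unfold machine; rewrite nth_error_app2; rewrite base_length; [|lia].
      rewrite !nth_error_map, nth_error_seq.
      replace (entry_address + S n - S entry_address) with n by lia.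
      destruct (Nat.ltb_spec n (code self)); [reflexivity | lia].
    + intros i; rewrite <- !upd_store; unfold upd; simpl delta.
      assert (E : store (fun _ => 0) i = 0)
        by (unfold store; destruct (Nat.even i); reflexivity).
      rewrite E; destruct (Nat.eqb i (vreg v_self)); lia.
    + rewrite Nat.add_succ_r, <- Nat.add_succ_l; apply IH; lia.
Qed.

Lemma machine_run s : cexec (cmain p) (store initial_store) (store s) ->
  reaches machine (start_address, fun _ => 0%Z)
    (if Nat.eqb (s v_verdict) 0 then 1 + exit_address else 2 + exit_address,
     counters_of (store s)).
Proof.
  intros H.
  replace (fun _ : nat => 0%Z) with
    (counters_of (store (upd (fun _ => 0) v_self 0))).
  2: { apply functional_extensionality; intros i; unfold counters_of, store.
       destruct (Nat.even i); upd_cases. }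
  eapply reaches_trans; [apply (chain_run (code self) 0); lia |].
  eapply reaches_trans; [apply reaches_keep; unfold entry_address;
    rewrite Nat.add_comm; apply (exit_code 3); reflexivity |].
  assert (Hc : code_at machine 0 (compile (cmain p) 0)).
  { intros i a Hi; apply machine_base; unfold base; rewrite Nat.add_0_l.
    rewrite nth_error_app1; [exact Hi |].
    apply nth_error_Some; rewrite Hi; discriminate. }
  destruct (Nat.eqb _ _);
    (eapply reaches_trans; [apply (compile_correct _ _ _ _ H 0 Hc) |];
     rewrite Nat.add_0_l; fold exit_address;
     eapply reaches_trans; [apply reaches_keep;
       rewrite <- (Nat.add_0_r exit_address) at 1; apply (exit_code 0); reflexivity |];
     rewrite store_vreg; apply reaches_refl).
Qed.

Lemma mstep_fixed P cf k : mstep P cf = cf -> Nat.iter k (mstep P) cf = cf.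
Proof. intros H; induction k; simpl; [|rewrite IHk]; auto. Qed.

Lemma mstep_bad P cf : nth_error P (fst cf) = Some Bad -> mstep P cf = cf.
Proof. intros H; unfold mstep; rewrite H; reflexivity. Qed.

(** Both [Bad] and the endless loop are fixed points of [mstep], so a run that arrives at one of
    them never visits the other. *)
Lemma self_input_tree s :
  cexec (cmain p) (store initial_store) (store s) ->
  (empty_tree self_input <-> s v_verdict <> 0).
Proof.
  intros H; destruct (machine_run s H) as [k Hk].
  destruct machine_ok as [Hlt Hok].
  split.
  - intros He Hv; rewrite Hv in Hk; simpl Nat.eqb in Hk; cbv iota in Hk.
    revert He; apply machine_tree_nonempty; [exact Hok | exact Hlt |].
    intros j Hj.
    assert (Hgood : nth_error machine (1 + exit_address)
      = Some (Move Keep 0 (1 + exit_address) (1 + exit_address)))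
      by (rewrite (Nat.add_comm 1) at 1; apply (exit_code 1); reflexivity).
    assert (Hfix : mstep machine (1 + exit_address, counters_of (store s))
                   = (1 + exit_address, counters_of (store s))).
    { unfold mstep; cbn [fst snd]; rewrite Hgood.
      destruct (Z.eqb _ _); f_equal; apply functional_extensionality;
        intros; apply Z.add_0_r. }
    destruct (Nat.le_ge_cases k j) as [Hle|Hle].
    + replace j with ((j - k) + k) in Hj by lia.
      rewrite Nat.iter_add, Hk, mstep_fixed in Hj by exact Hfix.
      cbn [fst] in Hj; congruence.
    + replace k with ((k - j) + j) in Hk by lia.
      rewrite Nat.iter_add, mstep_fixed in Hk.
      * rewrite Hk in Hj; cbn [fst] in Hj; congruence.
      * apply mstep_bad, Hj.
  - intros Hv h (T & HT & _); apply Nat.eqb_neq in Hv; rewrite Hv in Hk.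
    eapply no_trajectory_when_bad; [exact Hok | exact Hlt | | exact HT].
    rewrite Hk; cbn [fst]; rewrite Nat.add_comm; apply (exit_code 2); reflexivity.
Qed.

End Quine.

(** * The first output of a sound and complete program *)

(** Without a branch every node has a proper extension, so nodes would be arbitrarily long. *)
Lemma finite_tree_branch I :
  ~ empty_tree I -> finite_tree I -> exists h, is_branch I h.
Proof.
  intros Hne [l Hl]; apply NNPP; intros Hb.
  assert (H : forall n, exists h, in_tree I h /\ n <= length h).
  { induction n as [|n (h & Hh & Hn)].
    - apply not_all_not_ex; intros Hall; apply Hne; intros h Hh.
      apply (Hall h); split; [exact Hh | lia].
    - apply NNPP; intros Hno; apply Hb; exists h; split; [exact Hh |].
      intros h' Hh' (s & Hs & E); apply Hno; exists h'; split; [exact Hh' |].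
      rewrite E, length_app; destruct s; [contradiction | simpl; lia]. }
  destruct (H (S (list_max (map (@length item) l)))) as (h & Hh & Hn).
  assert (HM := proj1 (list_max_le (map (@length item) l) _) (Nat.le_refl _)).
  rewrite Forall_map, Forall_forall in HM.
  specialize (HM h (Hl h Hh)); lia.
Qed.

(** Something is printed in each case of the specification: a nonempty finite tree has a branch, and
    an enumeration reaches its first node after finitely many steps. *)
Lemma first_message p I : sound_and_complete_on p I ->
  exists k l m, output p (enc_input I) k = enc_message m :: l /\
    (empty_tree I <-> m = Inconsistent).
Proof.
  intros (He & Hf & Hi); destruct (classic (empty_tree I)) as [E|E].
  - destruct (He E) as (k & _ & Hk).
    exists k, [], Inconsistent; rewrite Hk; split; [reflexivity | tauto].
  - assert (HB : forall h, empty_tree I <-> Behavior h = Inconsistent)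
      by (intros h; split; [contradiction | discriminate]).
    destruct (classic (finite_tree I)) as [F|F].
    + destruct (Hf E F) as (k & hs & _ & Hk & Hhs).
      destruct (finite_tree_branch I E F) as [h Hh]; apply Hhs in Hh.
      destruct hs as [|h0 hs]; [contradiction |].
      exists k, (map (fun h => enc_message (Behavior h)) hs), (Behavior h0).
      rewrite Hk; split; [reflexivity | apply HB].
    + destruct (Hi F) as (_ & e & Hk & Hl & _).
      destruct (Hl 1) as [k Hk1]; destruct (Hk k) as [n Hn].
      rewrite Hn in Hk1; destruct n as [|n]; [simpl in Hk1; lia |].
      exists k; eexists; exists (Behavior (e 0)).
      rewrite Hn; split; [reflexivity | apply HB].
Qed.

Theorem theorem6 :
  ~ exists p : program,
      forall I : input,
        wf_input I ->
        derivative_add_constant_only (in_model I) ->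
        no_discontinuous_change (in_model I) ->
        sound_and_complete_on p I.
Proof.
  intros [p Hp]; destruct (machine_ok p) as [Hlt Hok].
  destruct (first_message p (self_input p)) as (k & l & m & Hk & Hm).
  { apply Hp.
    - apply machine_input_wf; assumption.
    - apply machine_model_class.
    - apply machine_model_continuous. }
  destruct (output_prints_first p k
    (Config 0 (update (fun _ => Leaf) 0 (enc_input (self_input p))) [])
    _ l eq_refl Hk) as [n Hn].
  destruct (cmain_spec p n _ Hn) as (s & Hs & Hv).
  rewrite (self_input_tree p s Hs), Hv in Hm.
  (* The constructor number of [Inconsistent] has code 0, so the tree is nonempty; that of
     [Behavior] is nonzero, so the tree is empty. *)
  destruct m as [|h].
  - apply (proj2 Hm eq_refl); reflexivity.
  - discriminate (proj1 Hm (cons_code_neq_0 _ _)).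
Qed.
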